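(* The following two assertions hold. (a) For every separable infinite-dimensional Hilbert space $H$ there exist a strict inductive limit $\Phi=\lim_{\rightarrow} H_i$ of a sequence $\{H_i\}_{i\in\mathbb{N}}$ of finite-dimensional Hilbert spaces and a map $\iota:\Phi\to H$ such that $(\Phi,H,\Phi')$ (with embedding $\iota$) is a rigged Hilbert space. (b) Conversely, for every strict inductive limit $\Phi=\lim_{\rightarrow} H_i$ of a sequence $\{H_i\}_{i\in\mathbb{N}}$ of finite-dimensional Hilbert spaces there exist a separable infinite-dimensional Hilbert space $H$ and a map $\iota:\Phi\to H$ such that $(\Phi,H,\Phi')$ (with embedding $\iota$) is a rigged Hilbert space.
   Context: All vector spaces are over $\mathbb{C}$, and LCVS means locally convex topological vector space. Inductive limit: let $\{H_i\}_{i\in\mathbb{N}}$ be an increasing sequence of LCVS, i.e. $H_i$ is a linear subspace of $H_{i+1}$ for all $i$, with continuous inclusion maps $\varphi_{ij}:H_i\to H_j$ for $i<j$. The inductive limit $\Phi=\lim_{\rightarrow}H_i$ is the vector space $\bigcup_{i=1}^{\infty}H_i$ endowed with the inductive locally convex topology with respect to the canonical embeddings $\varphi_i:H_i\to\Phi$, i.e. the finest locally convex topology making all $\varphi_i$ continuous. Strict inductive limit: the inductive limit is called strict if $H_i\neq H_{i+1}$ for all $i$ and the topology of $H_i$ coincides with the topology induced on $H_i$ from $H_{i+1}$, for all $i$. Rigged Hilbert space (RHS, also called Gelfand triple): let $\Phi$ be a complete nuclear space, $H$ a Hilbert space, and $\iota:\Phi\to H$ an injective continuous linear map with dense range. Then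 $(\Phi,H,\Phi')$ is called a rigged Hilbert space, where $\Phi'$ is the topological dual of $\Phi$. In particular, asserting that $(\Phi,H,\Phi')$ is a rigged Hilbert space with embedding $\iota$ includes asserting that $\Phi$ is complete and nuclear and that $\iota$ is linear, continuous and injective with dense range. *)

(* Defs.v *)
(* The field of complex numbers is R[i], for R : realType. *)
From HB Require Import structures.
From mathcomp Require Export all_boot all_order all_algebra.
From mathcomp Require Export complex.
From mathcomp Require Export all_classical all_reals all_analysis.
Export numFieldNormedType.Exports.

Set Implicit Arguments.
Unset Strict Implicit.
Unset Printing Implicit Defensive.

Import Order.TTheory GRing.Theory Num.Theory.

Local Open Scope classical_set_scope.
Local Open Scope ring_scope.

(* The norm is the one of the inner product, so completeness (and the topology)
   is that of the inner product; [inner] is linear in its first argument and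
   conjugate-linear in the second. *)
HB.mixin Record NormedModule_isHilbert (R : realType) H
    & CompleteNormedModule R[i] H := {
  inner : {dot H for (@Num.conj R[i])} ;
  inner_norm : forall x : H, inner x x = `|x| ^+ 2
}.

#[short(type="hilbertType")]
HB.structure Definition Hilbert (R : realType) :=
  {H of NormedModule_isHilbert R H & CompleteNormedModule R[i] H}.

Definition finite_dimensional (K : fieldType) (V : lmodType K) : Prop :=
  exists (n : nat) (e : 'I_n -> V),
    forall x : V, exists c : 'I_n -> K, x = \sum_(i < n) c i *: e i.

Definition separable (T : topologicalType) : Prop :=
  exists2 D : set T, countable D & dense D.

Section InductiveLimit.
Variable (K : numFieldType).

(* The inclusions H_i -> H_{i+1} of an increasing sequence are injective linear
   maps [j i], and Phi, the union of the H_i, is a space containing a copy of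
   each H_i via [phi i].
   A locally convex topology on the vector space Phi is the same thing as a
   linear bijection f from Phi to a locally convex space E: [indlim_finest] says
   that every locally convex topology on Phi for which all the canonical
   embeddings are continuous is coarser than that of Phi. *)
Record inductive_limit (H : nat -> tvsType K)
    (j : forall i, {linear H i -> H i.+1})
    (Phi : tvsType K) (phi : forall i, {linear H i -> Phi}) : Prop := {
  indlim_incl_inj : forall i, injective (j i) ;
  indlim_incl_continuous : forall i, continuous (j i) ;
  indlim_embed_inj : forall i, injective (phi i) ;
  indlim_embed_incl : forall i (x : H i), phi i.+1 (j i x) = phi i x ;
  indlim_union : \bigcup_i range (phi i) = [set: Phi] ;
  indlim_continuous : forall i, continuous (phi i) ;
  indlim_finest : forall (E : tvsType K) (f : {linear Phi -> E}),
    bijective f -> (forall i, continuous (f \o phi i)) -> continuous f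
}.

Record strict_inductive_limit (H : nat -> tvsType K)
    (j : forall i, {linear H i -> H i.+1})
    (Phi : tvsType K) (phi : forall i, {linear H i -> Phi}) : Prop := {
  strict_indlim : inductive_limit j phi ;
  strict_neq : forall i, range (j i) <> [set: H i.+1] ;
  strict_topology : forall i,
    (open : set (set (H i))) = [set j i @^-1` B | B in open]
}.

End InductiveLimit.

(* Completeness for the translation-invariant uniformity. The uniform structure
   packed in a [tvsType] is only required to induce its topology, hence the
   library's [cauchy] would be the wrong notion here. *)
Definition complete_tvs (K : numFieldType) (E : tvsType K) : Prop :=
  forall F : set_system E, ProperFilter F ->
    (xy.1 - xy.2) @[xy --> (F, F)] --> (0 : E) -> exists l : E, F --> l.

Section Nuclear.
Variable (K : numFieldType).

Record seminorm (E : lmodType K) (p : E -> K) : Prop := {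
  seminorm_ge0 : forall x, 0 <= p x ;
  seminormZ : forall (a : K) x, p (a *: x) = `|a| * p x ;
  seminormD : forall x y, p (x + y) <= p x + p y
}.

(* B, together with the canonical map pi, is the Banach space completing
   E / ker p for the norm induced by p. It always exists, and is unique up to a
   unique isometric isomorphism compatible with the canonical maps. *)
Record local_banach_space (E : lmodType K) (p : E -> K)
    (B : completeNormedModType K) (pi : {linear E -> B}) : Prop := {
  local_banach_norm : forall x, `|pi x| = p x ;
  local_banach_dense : dense (range pi)
}.

(* u = \sum_n lambda_n f_n(.) y_n with lambda summable, (f_n) bounded in the
   dual of X and (y_n) bounded in Y. *)
Definition nuclear_map (X Y : completeNormedModType K) (u : X -> Y) : Prop :=
  exists (lambda : nat -> K) (f : nat -> {linear X -> K^o}) (y : nat -> Y),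
  [/\ cvgn (series (fun n => `|lambda n|)),
      exists M : K, forall n x, `|f n x| <= M * `|x|,
      exists M : K, forall n, `|y n| <= M
    & forall x, series (fun n => (lambda n * f n x) *: y n) @ \oo --> u x].

(* For each continuous seminorm p there is a continuous seminorm q >= p such
   that the canonical map u between the local Banach spaces of q and p is
   nuclear. *)
Definition nuclear_space (E : tvsType K) : Prop :=
  forall p : E -> K, seminorm p -> continuous p ->
  exists q : E -> K,
  [/\ seminorm q, continuous q, (forall x, p x <= q x)
    & forall (Bq Bp : completeNormedModType K)
        (piq : {linear E -> Bq}) (pip : {linear E -> Bp})
        (u : {linear Bq -> Bp}),
      local_banach_space q piq -> local_banach_space p pip ->
      continuous u -> (forall x, u (piq x) = pip x) -> nuclear_map u].

End Nuclear.

(* The third member of the triple, the topological dual of Phi, is determined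
   by Phi. *)
Record rigged_hilbert_space (R : realType) (Phi : tvsType R[i])
    (H : hilbertType R) (iota : Phi -> H) : Prop := {
  rigged_complete : complete_tvs Phi ;
  rigged_nuclear : nuclear_space Phi ;
  rigged_linear : linear iota ;
  rigged_continuous : continuous iota ;
  rigged_injective : injective iota ;
  rigged_dense : dense (range iota)
}.

(* Main.v *)
(* The space of finite sequences, with the finest locally convex topology, is the
   strict inductive limit of the spaces C^i. On a direct sum of countably many
   lines the finest locally convex topology is the box topology, whose basic
   neighbourhoods of 0 are { y | |y_k| < r_k for all k } with r_k > 0 arbitrary:
   choosing the r_k small enough absorbs any given sequence of constants, so that
   every linear map to a locally convex space and every seminorm is continuous.
   Completeness: the coordinatewise limit l of a Cauchy filter is finite, for
   otherwise radii r_k = |l_k| / 2 contradict the Cauchy property. Nuclearity: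
   a seminorm p is dominated by the weighted l^1 norm q with weights
   w_k = 2^k (p(e_k) + 1), and the canonical map is
   sum_k 2^-k (w_k x_k) (e_k / (p(e_k) + 1)).
   For (a), a linearly independent sequence extracted from a countable dense subset
   of H still has dense span and defines iota. For (b), a basis of Phi identifies Phi
   with the space of finite sequences, which embeds densely in l^2(N). *)
From HB Require Import structures.
Require Import Defs.
From mathcomp Require Import ring.

Set Implicit Arguments.
Unset Strict Implicit.
Unset Printing Implicit Defensive.

Import Order.TTheory GRing.Theory Num.Theory.

Local Open Scope classical_set_scope.
Local Open Scope ring_scope.

(** * Limits over numeric fields, and completeness of R[i] *)

Lemma cvg_norm_le (K : numFieldType) (V : normedModType K) (T : Type)
    (F : set_system T) {FF : ProperFilter F} (f : T -> V) (l z : V) (r : K) :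
  f @ F --> l -> (\forall t \near F, `|f t - z| <= r) -> `|l - z| <= r.
Proof.
move=> fl fr; apply/ler_addgt0Pl => e e0.
near F => t.
have -> : l - z = (l - f t) + (f t - z) by rewrite addrA subrK.
apply: (le_trans (ler_normD _ _)); apply: lerD; last by near: t.
apply: ltW; near: t; exact: cvgr_dist_lt fl _ e0.
Unshelve. all: by end_near. Qed.

(** The order of [K] is only partial, so the sign of the limit is read off from the norm: [M - f t]
    is eventually equal to its own norm, hence so is its limit [M - l]. *)
Lemma cvg_le_numField (K : numFieldType) (T : Type) (F : set_system T)
    {FF : ProperFilter F} (f : T -> K) (l M : K) :
  f @ F --> l -> (\forall t \near F, f t <= M) -> l <= M.
Proof.
move=> fl fM; rewrite -subr_ge0.
have cM : (fun t => M - f t) @ F --> M - l by apply: cvgB => //; exact: cvg_cst.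
have cN : (fun t => `|M - f t|) @ F --> `|M - l| by exact: cvg_norm.
suff -> : M - l = `|M - l| by [].
apply: (cvg_unique (@norm_hausdorff _ K) (F:=(fun t => M - f t) @ F)) => //.
apply: cvg_trans cN; apply: near_eq_cvg; near=> t.
by rewrite ger0_norm // subr_ge0; near: t.
Unshelve. all: by end_near. Qed.

Lemma cvg_ge_numField (K : numFieldType) (T : Type) (F : set_system T)
    {FF : ProperFilter F} (f : T -> K) (l M : K) :
  f @ F --> l -> (\forall t \near F, M <= f t) -> M <= l.
Proof.
move=> fl fM; rewrite -lerN2.
apply: (@cvg_le_numField _ _ _ FF (fun t => - f t)); first exact: cvgN.
by apply: filterS fM => t; rewrite lerN2.
Qed.

Lemma cvgn_ext (T : topologicalType) (u v : nat -> T) (l : T) :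
  u =1 v -> u @ \oo --> l -> v @ \oo --> l.
Proof. by move/funext=> ->. Qed.

Lemma cvg_comb2 (K : numFieldType) (c : K) (u v : nat -> K) (a b : K) :
  u @ \oo --> a -> v @ \oo --> b -> (fun n => c * u n + v n) @ \oo --> c * a + b.
Proof. by move=> ua vb; apply: cvgD => //; apply: cvgM => //; exact: cvg_cst. Qed.

Lemma cvg_comb4 (K : numFieldType) (c d : K) (s1 s2 s3 s4 : nat -> K) (a1 a2 a3 a4 : K) :
  s1 @ \oo --> a1 -> s2 @ \oo --> a2 -> s3 @ \oo --> a3 -> s4 @ \oo --> a4 ->
  (fun n => c * (s1 n - s2 n + d * s3 n - d * s4 n)) @ \oo --> c * (a1 - a2 + d * a3 - d * a4).
Proof.
move=> h1 h2 h3 h4; apply: cvgM; first exact: cvg_cst.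
by apply: cvgB; [apply: cvgD; [exact: cvgB|]|]; apply: cvgM => //; exact: cvg_cst.
Qed.

Lemma lipschitz_continuous (K : numFieldType) (V W : normedModType K) (f : V -> W) (M : K) :
  0 <= M -> (forall x y, `|f x - f y| <= M * `|x - y|) -> continuous f.
Proof.
move=> M0 fM x; have M1 : 0 < M + 1 by rewrite ltr_wpDl.
apply/cvgrPdist_le => e e0; near=> y.
apply: (le_trans (fM x y)); apply: (@le_trans _ _ ((M + 1) * `|x - y|)).
  by rewrite ler_wpM2r // lerDl.
rewrite mulrC -ler_pdivlMr //; near: y.
exact: (@cvgr_dist_le _ _ _ (nbhs x) _ id x cvg_id _ (divr_gt0 e0 M1)).
Unshelve. all: by end_near. Qed.

Lemma isometry_continuous (K : numFieldType) (V W : normedModType K) (f : V -> W) :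
  (forall x y, `|f x - f y| = `|x - y|) -> continuous f.
Proof. by move=> fd; apply: (lipschitz_continuous ler01) => x y; rewrite mul1r fd. Qed.

Section complex_topology.
Local Open Scope complex_scope.

Variable R : realType.
Local Notation C := (R[i] : numFieldType).
Local Notation Re := (@complex.Re R).
Local Notation Im := (@complex.Im R).

Lemma ReB (x y : C) : Re (x - y) = Re x - Re y.
Proof. by case: x y => [? ?] []. Qed.

Lemma ImB (x y : C) : Im (x - y) = Im x - Im y.
Proof. by case: x y => [? ?] []. Qed.

Lemma norm_Re_le (z : C) : `|Re z|%:C <= `|z|.
Proof. exact: normc_ge_Re. Qed.

Lemma norm_Im_le (z : C) : `|Im z|%:C <= `|z|.
Proof.
have := normc_ge_Re (z * 'i); rewrite ReiNIm normrN normrM.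
suff -> : `|('i : C)| = 1 by rewrite mulr1.
by rewrite normc_def /= expr0n /= add0r expr1n sqrtr1.
Qed.

Lemma norm_ReB_le (x y : C) : `|Re x - Re y|%:C <= `|x - y|.
Proof. by rewrite -ReB norm_Re_le. Qed.

Lemma norm_ImB_le (x y : C) : `|Im x - Im y|%:C <= `|x - y|.
Proof. by rewrite -ImB norm_Im_le. Qed.

Lemma norm_le_ReIm (z : C) : `|z| <= (`|Re z| + `|Im z|)%:C.
Proof.
rewrite {1}[z]complexE (le_trans (ler_normD _ _)) // rmorphD /= normrM.
suff -> : `|('i : C)| = 1 by rewrite mul1r !normc_def /= expr0n /= !addr0 !sqrtr_sqr.
by rewrite normc_def /= expr0n /= add0r expr1n sqrtr1.
Qed.

(** Real and imaginary parts are 1-Lipschitz, so they send [F] to Cauchy filters of [R];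
    [norm_le_ReIm] recombines the two limits. *)
Lemma complex_complete (F : set_system C) :
  ProperFilter F -> cauchy F -> exists l : C, F --> l.
Proof.
move=> FF /cauchyP Fc.
have ReF : cauchy (Re @ F).
  apply/cauchyP => e e0.
  have [|z Fz] := Fc e%:C; first by rewrite ltcR.
  exists (Re z); rewrite -!ball_normE /=; apply: (filterS _ Fz) => y; rewrite -!ball_normE /= => zy.
  by rewrite -ltcR; apply: (le_lt_trans (norm_ReB_le z y)).
have ImF : cauchy (Im @ F).
  apply/cauchyP => e e0.
  have [|z Fz] := Fc e%:C; first by rewrite ltcR.
  exists (Im z); rewrite -!ball_normE /=; apply: (filterS _ Fz) => y; rewrite -!ball_normE /= => zy.
  by rewrite -ltcR; apply: (le_lt_trans (norm_ImB_le z y)).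
have [a Fa] : exists a : R, Re @ F --> a by apply/cvg_ex; exact: R_complete.
have [b Fb] : exists b : R, Im @ F --> b by apply/cvg_ex; exact: R_complete.
exists (a +i* b); apply/cvgrPdist_lt => e e0.
(* A positive element of [R[i]] is real, so [e] comes from [R] and can be split in halves between
   the two coordinates. *)
have e2 : 0 < Re e / 2.
  by move: e0; rewrite ltcE /= => /andP[_ e0]; rewrite divr_gt0.
have eE : e = (Re e / 2 + Re e / 2)%:C.
  by rewrite -splitr RRe_real // gtr0_real.
near=> z; rewrite eE; apply: (le_lt_trans (norm_le_ReIm _)); rewrite ltcR.
rewrite ReB ImB /=; apply: ltrD; near: z.
- exact: cvgr_dist_lt Fa _ e2.
- exact: cvgr_dist_lt Fb _ e2.
Unshelve. all: by end_near. Qed.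

Lemma real_complex_continuous : continuous (fun x : R => x%:C : C).
Proof.
move=> x; apply/cvgrPdist_lt => e e0.
have e2 : 0 < Re e by move: e0; rewrite ltcE /= => /andP[_ e0].
have eE : e = (Re e)%:C by rewrite RRe_real // gtr0_real.
near=> z; rewrite eE -rmorphB /= normc_def /= expr0n /= addr0 sqrtr_sqr ltcR.
by near: z; exact: (@cvgr_dist_lt _ _ _ (nbhs x) _ id x cvg_id _ e2).
Unshelve. all: by end_near. Qed.

End complex_topology.

(** * Cauchy-Schwarz and triangle inequalities *)

Section dot_product.
Variables (K : numClosedFieldType) (U : lmodType K) (f : {dot U for (@Num.conj K)}).

Lemma dot_cauchy_schwarz u v : `|f u v| <= sqrtC (f u u) * sqrtC (f v v).
Proof.
rewrite -[leLHS]sqrCK // -sqrtCM ?nnegrE ?dnorm_ge0 //.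
rewrite ler_sqrtC ?nnegrE ?mulr_ge0 ?exprn_ge0 ?dnorm_ge0 //.
have [->|v0] := eqVneq v 0; first by rewrite !linear0r normr0 expr0n.
have fv : 0 < f v v by rewrite dnorm_gt0.
(* The coefficient of the orthogonal projection of [u] on [v]: with this choice the nonnegativity of
   [f] at [u - a *: v] is exactly the squared inequality. *)
pose a := f u v / f v v.
have := dnorm_ge0 f (u - a *: v).
rewrite dnormB dnormZ linearZr_LR /=.
have -> : a^* * f u v = `|f u v| ^+ 2 / f v v.
  by rewrite rmorphM /= fmorphV /= (CrealP (gtr0_real fv)) normCK mulrAC [_^* * _]mulrC.
have -> : (`|f u v| ^+ 2 / f v v)^* = `|f u v| ^+ 2 / f v v.
  by apply/CrealP/ger0_real; rewrite divr_ge0 ?exprn_ge0 ?dnorm_ge0.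
have -> : `|a| ^+ 2 * f v v = `|f u v| ^+ 2 / f v v.
  rewrite normrM normfV (gtr0_norm fv) exprMn -mulrA; congr (_ * _).
  by rewrite exprVn expr2 invfM -mulrA mulVf ?mulr1 // gt_eqF.
by rewrite opprD addrA addrK subr_ge0 ler_pdivrMr.
Qed.

Lemma dot_triangle u v : sqrtC (f (u + v) (u + v)) <= sqrtC (f u u) + sqrtC (f v v).
Proof.
rewrite -[leRHS]sqrCK ?addr_ge0 ?sqrtC_ge0 ?dnorm_ge0 //.
rewrite ler_sqrtC ?nnegrE ?exprn_ge0 ?addr_ge0 ?sqrtC_ge0 ?dnorm_ge0 //.
rewrite dnormD sqrrD !sqrtCK [leRHS]addrAC lerD2l.
have real : f u v + (f u v)^* \is Num.real.
  by rewrite CrealE rmorphD /= conjCK addrC.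
apply: (le_trans (real_ler_norm real)); apply: (le_trans (ler_normD _ _)).
by rewrite norm_conjC -mulr2n lerMn2r dot_cauchy_schwarz.
Qed.

End dot_product.

(** * Square summable sequences *)

Section square_summable.
Variable R : realType.
Local Notation C := (R[i] : numFieldType).

(** Nonnegative terms are real, so this is monotone convergence in [R], carried back to [R[i]] by
    the continuous embedding. *)
Lemma complex_nonneg_series_cvg (u : nat -> C) (M : C) :
  (forall k, 0 <= u k) -> (forall n, series u n <= M) ->
  exists l : C, series u @ \oo --> l.
Proof.
move=> u0 uM.
have uE k : u k = (complex.Re (u k))%:C%C by rewrite RRe_real // ger0_real.
pose v k := complex.Re (u k).
have vE n : series u n = (series v n)%:C%C.
  by rewrite /series /= rmorph_sum /=; apply: eq_bigr => k _; exact: uE.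
have [a va] : exists a : R, series v @ \oo --> a.
  apply/cvg_ex/nondecreasing_is_cvgn.
    by apply: nondecreasing_series => k _ _; rewrite -ler0c -uE.
  exists (complex.Re M) => _ [n _ <-].
  by have := uM n; rewrite vE lecE /= => /andP[].
exists (a%:C%C); rewrite (_ : series u = (fun x : R => x%:C%C : C) \o series v).
  by apply: continuous_cvg => //; exact: real_complex_continuous.
by apply/funext => n /=; rewrite vE.
Qed.

Definition square_summable (u : nat -> C) :=
  exists M : C, forall n, series (fun k => `|u k| ^+ 2) n <= M.

Lemma square_summable_cvg (u : nat -> C) : square_summable u ->
  exists l : C, series (fun k => `|u k| ^+ 2) @ \oo --> l.
Proof.
by case=> M uM; apply: (complex_nonneg_series_cvg _ uM) => k; rewrite exprn_ge0.
Qed.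

Lemma square_summableZ (a : C) (u : nat -> C) :
  square_summable u -> square_summable (fun k => a * u k).
Proof.
case=> M uM; exists (`|a| ^+ 2 * M) => n.
rewrite /series /=; under eq_bigr do rewrite normrM exprMn.
by rewrite -mulr_sumr ler_wpM2l ?exprn_ge0 //; exact: uM.
Qed.

Lemma square_summableD (u v : nat -> C) :
  square_summable u -> square_summable v -> square_summable (fun k => u k + v k).
Proof.
case=> [M uM] [N vN]; exists (2 * M + 2 * N) => n.
apply: (@le_trans _ _
  (2 * series (fun k => `|u k| ^+ 2) n + 2 * series (fun k => `|v k| ^+ 2) n)).
  rewrite /series /= !mulr_sumr -big_split /=; apply: ler_sum => k _.
  apply: (@le_trans _ _ ((`|u k| + `|v k|) ^+ 2)).
    by rewrite ler_sqr ?nnegrE ?addr_ge0 // ler_normD.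
  rewrite -subr_ge0.
    have -> : 2 * `|u k| ^+ 2 + 2 * `|v k| ^+ 2 - (`|u k| + `|v k|) ^+ 2
      = (`|u k| - `|v k|) ^+ 2 by ring.
    by rewrite real_exprn_even_ge0 ?realB ?normr_real.
by rewrite lerD // ler_pM2l ?ltr0n.
Qed.

Lemma polarization (x y : C) : x * (y : R[i])^* =
  4^-1 * (`|x + y| ^+ 2 - `|x + (-1) * y| ^+ 2 + 'i * `|x + 'i * y| ^+ 2
          - 'i * `|x + (- 'i) * y| ^+ 2).
Proof.
rewrite !(normCK (x + _ : R[i])) !rmorphD !rmorphM !rmorphN !rmorph1 /=.
rewrite conjCi.
set z := x^*; set t := y^*.
have i2 : 'i * 'i = -1 :> R[i] by rewrite -expr2 sqrCi.
apply: (@mulfI _ 4); first by rewrite pnatr_eq0.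
rewrite [RHS]mulrA divff ?pnatr_eq0 // mul1r.
(* Both uses of [ring] treat ['i] as an indeterminate; the intermediate form isolates the only place
   where its square has to be replaced by -1. *)
transitivity (2 * x * t + 2 * y * z - 'i * 'i * (2 * x * t - 2 * y * z)).
  by rewrite i2; ring.
ring.
Qed.

End square_summable.

Definition ell2_pred (R : realType) (A : pred nat) : {pred nat -> (R[i])^o} :=
  [pred u | `[< square_summable u /\ forall k, ~~ A k -> u k = 0 >]].

Lemma ell2_submod_closed (R : realType) (A : pred nat) : submod_closed (@ell2_pred R A).
Proof.
split.
  apply/asboolP; split => //; exists 0 => n.
  by rewrite /series /= big1 // => k _; rewrite normr0 expr0n.
move=> a u v /asboolP[su u0] /asboolP[sv v0]; apply/asboolP; split.
  by apply: square_summableD => //; exact: square_summableZ.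
by move=> k Ak; change (a * u k + v k = 0); rewrite u0 // v0 // mulr0 addr0.
Qed.

HB.instance Definition _ (R : realType) (A : pred nat) :=
  GRing.isSubmodClosed.Build R[i] (nat -> (R[i])^o) (@ell2_pred R A) (@ell2_submod_closed R A).

(* A is the set of allowed indices: [xpredT] gives l^2(N), and [fun k => k < i] gives C^i. *)
Record ell2 (R : realType) (A : pred nat) := Ell2 {
  ell2_fun :> nat -> (R[i])^o;
  _ : ell2_fun \in @ell2_pred R A }.

Section ell2.
Variables (R : realType) (A : pred nat).

HB.instance Definition _ := [isSub for @ell2_fun R A].
HB.instance Definition _ := [Choice of ell2 R A by <:].
HB.instance Definition _ := [SubChoice_isSubLmodule of ell2 R A by <:].

End ell2.

Section ell2_inner.
Variables (R : realType) (A : pred nat).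
Local Notation C := (R[i] : numFieldType).
Implicit Types x y z : ell2 R A.

Lemma ell2P x : square_summable x.
Proof. by case: x => u /= /asboolP[]. Qed.

Lemma ell2_supp x k : ~~ A k -> x k = 0.
Proof. by case: x => u /= /asboolP[_]; exact. Qed.

Lemma ell2_ext x y : x =1 y -> x = y.
Proof. by move=> xy; apply/val_inj/funext. Qed.

Lemma ell2D x y k : (x + y) k = x k + y k. Proof. by []. Qed.
Lemma ell2N x k : (- x) k = - x k. Proof. by []. Qed.
Lemma ell2Z (a : R[i]) x k : (a *: x) k = a * x k. Proof. by []. Qed.

Lemma ell2_sum (I : Type) (r : seq I) (P : pred I) (F : I -> ell2 R A) k :
  (\sum_(i <- r | P i) F i) k = \sum_(i <- r | P i) F i k.
Proof. by elim/big_rec2: _ => //= i x y _ <-. Qed.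

Definition ell2_partial x y : nat -> C :=
  series (fun k => (x k : R[i]) * (y k : R[i])^*).

Definition ell2_inner x y : C := limn (ell2_partial x y).

(** Polarization writes the partial sums as a fixed combination of the partial sums of the squared
    norms of [x + a y] for [a] = 1, -1, ['i], [- 'i], and these four series converge. *)
Lemma ell2_partial_cvg x y : ell2_partial x y @ \oo --> ell2_inner x y.
Proof.
suff [l Hl] : exists l : C, ell2_partial x y @ \oo --> l.
  by rewrite /ell2_inner (cvg_lim _ Hl) //; exact: norm_hausdorff.
have cv (a : C) := square_summable_cvg (square_summableD (ell2P x) (square_summableZ a (ell2P y))).
have [a1 h1] := cv 1; have [a2 h2] := cv (-1); have [a3 h3] := cv 'i; have [a4 h4] := cv (- 'i).
exists (4^-1 * (a1 - a2 + 'i * a3 - 'i * a4)).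
apply: cvgn_ext (@cvg_comb4 C 4^-1 ('i : R[i]) _ _ _ _ _ _ _ _ h1 h2 h3 h4) => n.
rewrite /ell2_partial /series /= !mulr_sumr -!sumrB -big_split -sumrB /= mulr_sumr.
by apply: eq_bigr => k _; rewrite polarization mul1r.
Qed.

Lemma ell2_inner_unique x y (l : C) : ell2_partial x y @ \oo --> l -> ell2_inner x y = l.
Proof. by move=> h; apply: cvg_lim => //; exact: norm_hausdorff. Qed.

Lemma ell2_innerDl (a : R[i]) x y z :
  ell2_inner (a *: x + y) z = a * ell2_inner x z + ell2_inner y z.
Proof.
apply: ell2_inner_unique.
apply: cvgn_ext (@cvg_comb2 C a _ _ _ _ (@ell2_partial_cvg x z) (@ell2_partial_cvg y z)) => n.
rewrite /ell2_partial /series /= mulr_sumr -big_split /=.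
by apply: eq_bigr => k _; rewrite mulrDl mulrA.
Qed.

Lemma ell2_innerC x y : ell2_inner x y = (ell2_inner y x : R[i])^*.
Proof.
apply: ell2_inner_unique.
rewrite (_ : ell2_partial _ _ = (@Num.conj R[i] : C -> C) \o ell2_partial y x).
  apply: continuous_cvg; last exact: ell2_partial_cvg.
  by apply: isometry_continuous => u v; rewrite -rmorphB norm_conjC.
apply/funext => n; rewrite /ell2_partial /series /= rmorph_sum /=.
by apply: eq_bigr => k _; rewrite rmorphM /= conjCK mulrC.
Qed.

Lemma ell2_partial_diag x n : ell2_partial x x n = series (fun k => `|x k| ^+ 2 : C) n.
Proof. by rewrite /ell2_partial /series /=; apply: eq_bigr => k _; rewrite normCK. Qed.

Lemma ell2_partial_le x n : ell2_partial x x n <= ell2_inner x x.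
Proof.
apply: (cvg_ge_numField (@ell2_partial_cvg x x)); near=> m.
have nm : (n <= m)%N by near: m; exists n.
rewrite !ell2_partial_diag /series /= (big_cat_nat _ nm) //= lerDl.
by apply: sumr_ge0 => k _; rewrite exprn_ge0.
Unshelve. all: by end_near. Qed.

Lemma ell2_inner_le x (M : C) : (forall n, series (fun k => `|x k| ^+ 2 : C) n <= M) ->
  ell2_inner x x <= M.
Proof.
move=> H; apply: (cvg_le_numField (@ell2_partial_cvg x x)); near=> n.
by rewrite ell2_partial_diag.
Unshelve. all: by end_near. Qed.

Lemma ell2_coord_sqr_le x k : `|x k| ^+ 2 <= ell2_inner x x.
Proof.
apply: le_trans (ell2_partial_le x k.+1).
rewrite ell2_partial_diag /series /= big_nat_recr //= lerDr.
by apply: sumr_ge0 => i _; rewrite exprn_ge0.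
Qed.

Lemma ell2_inner_gt0 x : x != 0 -> 0 < ell2_inner x x.
Proof.
move=> x0; have [k xk] : exists k, x k != 0.
  apply: contrapT => h; move/eqP: x0; apply; apply/ell2_ext => k.
  by apply/eqP/negPn/negP => xk; apply: h; exists k.
by apply: lt_le_trans (ell2_coord_sqr_le x k); rewrite exprn_gt0 // normr_gt0.
Qed.

End ell2_inner.

Lemma cvg_series_sqr_dist (K : numFieldType) (T : Type) (F : set_system T) {FF : Filter F}
    (f : T -> nat -> K) (u l : nat -> K) n : (forall k, (fun t => f t k) @ F --> l k) ->
  (fun t => series (fun k => `|u k - f t k| ^+ 2) n) @ F --> series (fun k => `|u k - l k| ^+ 2) n.
Proof.
move=> fl; rewrite /series /=; apply: cvg_big; first exact: add_continuous.
move=> k _; rewrite expr2; under eq_fun do rewrite expr2.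
have h : (fun t => `|u k - f t k|) @ F --> `|u k - l k|.
  by apply: cvg_norm; apply: cvgB => //; exact: cvg_cst.
exact: cvgM.
Qed.

Section ell2_dot.
Variables (R : realType) (A : pred nat).
Local Notation C := (R[i] : numFieldType).

Lemma ell2_inner_bilinear :
  bilinear_for ( *%R : GRing.Scale.law R[i] R[i])
    (Num.conj \; ( *%R ) : GRing.Scale.law R[i] R[i]) (@ell2_inner R A : _ -> _ -> R[i]).
Proof.
split=> u a x y; first exact: ell2_innerDl.
rewrite (ell2_innerC u (_ + _)) ell2_innerDl rmorphD rmorphM /=.
by rewrite (ell2_innerC u x) (ell2_innerC u y).
Qed.

HB.instance Definition _ := @bilinear_isBilinear.Build R[i] (ell2 R A) (ell2 R A) R[i]
  *%R (Num.conj \; ( *%R )) (@ell2_inner R A : _ -> _ -> R[i]) ell2_inner_bilinear.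

Lemma ell2_inner_hermitian (x y : ell2 R A) :
  ell2_inner x y = (-1) ^+ false * (ell2_inner y x : R[i])^*.
Proof. by rewrite mul1r -ell2_innerC. Qed.

HB.instance Definition _ := @isHermitianSesquilinear.Build R[i] (ell2 R A) false
  (@Num.conj R[i]) (@ell2_inner R A : _ -> _ -> R[i]) ell2_inner_hermitian.

HB.instance Definition _ := @isDotProduct.Build R[i] (ell2 R A)
  (@ell2_inner R A : _ -> _ -> R[i]) (@ell2_inner_gt0 R A).

Definition ell2_dot : {dot (ell2 R A) for (@Num.conj R[i])} := (@ell2_inner R A : _ -> _ -> R[i]).

Definition ell2_norm (x : ell2 R A) : R[i] := sqrtC (ell2_dot x x).

Lemma ell2_normD x y : ell2_norm (x + y) <= ell2_norm x + ell2_norm y.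
Proof. exact: dot_triangle. Qed.

Lemma ell2_normZ (a : R[i]) x : ell2_norm (a *: x) = `|a| * ell2_norm x.
Proof.
rewrite /ell2_norm dnormZ sqrtCM ?nnegrE ?exprn_ge0 ?dnorm_ge0 //.
by rewrite sqrCK.
Qed.

Lemma ell2_norm_eq0 x : ell2_norm x = 0 -> x = 0.
Proof. by move=> /eqP; rewrite sqrt_dnorm_eq0 => /eqP. Qed.

HB.instance Definition _ := @Lmodule_isNormed.Build R[i] (ell2 R A) ell2_norm
  ell2_normD ell2_normZ ell2_norm_eq0.

Lemma ell2_norm_sqr (x : ell2 R A) : `|x| ^+ 2 = ell2_dot x x.
Proof. exact: sqrtCK. Qed.

Lemma ell2_coord_le (x : ell2 R A) k : `|x k| <= `|x|.
Proof.
rewrite -(@ler_sqr R[i]) ?nnegrE // ell2_norm_sqr; exact: ell2_coord_sqr_le.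
Qed.

Lemma ell2_norm_le (x : ell2 R A) (M : R[i]) : 0 <= M ->
  (forall n, series (fun k => `|x k| ^+ 2 : C) n <= M ^+ 2) -> `|x| <= M.
Proof.
move=> M0 h; rewrite -(@ler_sqr R[i]) ?nnegrE // ell2_norm_sqr; exact: ell2_inner_le.
Qed.

(** The coordinatewise limit [l] exists because coordinates are 1-Lipschitz; it remains to see that
    [l] belongs to the space and that the convergence holds in norm. *)
Lemma ell2_complete (F : set_system (ell2 R A)) :
  ProperFilter F -> cauchy F -> cvg F.
Proof.
move=> FF /cauchyP Fc.
have coordF k : exists l : C, (fun x : ell2 R A => x k : C) @ F --> l.
  apply: complex_complete; apply/cauchyP => e e0.
  have [x Fx] := Fc e e0; exists (x k : C); rewrite -!ball_normE /=.
  apply: (filterS _ Fx) => y; rewrite -!ball_normE /=.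
  by apply: le_lt_trans; exact: (ell2_coord_le (x - y)).
have [l lP] := choice coordF.
(* A finite partial sum of squares is continuous in the coordinates, so the Cauchy bound on [x - y]
   passes to the limit in [y], with a bound that does not depend on [n]. *)
have close (e : C) : 0 < e -> F [set x : ell2 R A | forall n,
   series (fun k => `|(x k : C) - l k| ^+ 2) n <= e ^+ 2].
  move=> e0; have [x0 Fx0] := Fc (e / 2) (divr_gt0 e0 (ltr0n _ 2)).
  near=> x => n.
  have x0x : `|x0 - x| < e / 2.
    by have : ball x0 (e / 2) x by [near: x]; rewrite -ball_normE.
  have cv : (fun y : ell2 R A => series (fun k => `|(x k : C) - y k| ^+ 2) n) @ F -->
       series (fun k => `|(x k : C) - l k| ^+ 2) n.
    exact: (cvg_series_sqr_dist (f := fun y : ell2 R A => (y : nat -> C))).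
  apply: (cvg_le_numField cv); near=> y.
  have x0y : `|x0 - y| < e / 2.
    by have : ball x0 (e / 2) y by [near: y]; rewrite -ball_normE.
  have xy : `|x - y| <= e.
    rewrite [e]splitr (le_trans _ (lerD (ltW x0x) (ltW x0y))) // distrC.
    have -> : y - x = (x0 - x) - (x0 - y) by rewrite opprB [RHS]addrC addrA subrK.
    exact: ler_normB.
  apply: (@le_trans _ _ (`|x - y| ^+ 2)); last by rewrite ler_sqr ?nnegrE // ltW.
  rewrite ell2_norm_sqr; have := ell2_partial_le (x - y) n.
  by rewrite ell2_partial_diag; apply.
have l0 k : ~~ A k -> l k = 0.
  move=> Ak; apply: (@norm_cvg_unique _ C _ _ _ _ (lP k)).
  rewrite (_ : (fun x : ell2 R A => x k : C) = fun=> 0); first exact: cvg_cst.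
  by apply/funext => x; rewrite ell2_supp.
have /filter_ex[x0 h0] := close 1 ltr01.
have ls : square_summable l.
  (* [l] is recovered as [x0 - (x0 - l)], a combination of two square summable sequences. *)
  have : square_summable (fun k => (x0 k : C) + -1 * ((x0 k : C) - l k)).
    apply: square_summableD; first exact: ell2P.
    by apply: square_summableZ; exists (1 ^+ 2).
  rewrite (_ : (fun k => _) = l) //; apply/funext => k.
  by rewrite mulN1r subKr.
have lin : l \in @ell2_pred R A by apply/asboolP.
pose L : ell2 R A := Ell2 lin.
apply/cvg_ex; exists L; apply/cvgrPdist_le => e e0; near=> x.
rewrite distrC; apply: ell2_norm_le; first exact: ltW.
by near: x; exact: close.
Unshelve. all: by end_near. Qed.

HB.instance Definition _ := Uniform_isComplete.Build (ell2 R A) ell2_complete.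

HB.instance Definition _ := @NormedModule_isHilbert.Build R (ell2 R A) ell2_dot
  (fun x => esym (ell2_norm_sqr x)).

End ell2_dot.

(** * Finite sequences with the box topology *)

(* The coefficients of a polynomial are used as the coordinates of a finite sequence;
   'X^k is the k-th unit vector. *)
Definition finseq (K : numFieldType) := {poly K}.

Section finseq_topology.
Variable K : numFieldType.

HB.instance Definition _ := GRing.Lmodule.on (finseq K).

Definition box (x : finseq K) (r : nat -> K) : set (finseq K) :=
  [set y : finseq K | forall k, `|y`_k - x`_k| < r k].

Definition box_nbhs (x : finseq K) : set_system (finseq K) :=
  [set U | exists2 r, (forall k, 0 < r k) & box x r `<=` U].

HB.instance Definition _ := hasNbhs.Build (finseq K) box_nbhs.

Lemma box_refl (x : finseq K) (r : nat -> K) : (forall k, 0 < r k) -> box x r x.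
Proof. by move=> r0 k; rewrite subrr normr0. Qed.

Lemma box_nbhs_filter (x : finseq K) : ProperFilter (nbhs x).
Proof.
split.
  by case=> r r0 h; have := h x (box_refl x r0).
split.
- by exists (fun=> 1) => // k; rewrite ltr01.
- move=> U V [r r0 rU] [s s0 sV].
  have rs0 k : 0 < r k + s k by rewrite addr_gt0.
  (* A positive quantity below both [r k] and [s k], in place of their minimum. *)
  exists (fun k => r k * s k / (r k + s k)).
    by move=> k; rewrite divr_gt0 ?mulr_gt0.
  move=> y xy; split; [apply: rU|apply: sV] => k; apply: lt_le_trans (xy k) _.
    by rewrite ler_pdivrMr // ler_pM2l // lerDr ltW.
  by rewrite ler_pdivrMr // mulrC ler_pM2l // lerDl ltW.
- by move=> U V UV [r r0 rU]; exists r => // y /rU/UV.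
Qed.

Lemma box_nbhs_singleton (x : finseq K) U : nbhs x U -> U x.
Proof. by case=> r r0; apply; exact: box_refl. Qed.

Lemma box_open (x : finseq K) r y : box x r y -> nbhs y (box x r).
Proof.
move=> xy; exists (fun k => r k - `|y`_k - x`_k|) => [k|z yz k].
  by rewrite subr_gt0.
have -> : z`_k - x`_k = (z`_k - y`_k) + (y`_k - x`_k) by rewrite addrA subrK.
by apply: le_lt_trans (ler_normD _ _) _; rewrite -ltrBrDr.
Qed.

Lemma box_nbhs_nbhs (x : finseq K) U : nbhs x U -> nbhs x (nbhs^~ U).
Proof.
case=> r r0 rU; exists r => // y /box_open yr.
by have [s s0 h] := yr; exists s => // z /h/rU.
Qed.

HB.instance Definition _ := Nbhs_isNbhsTopological.Build (finseq K)
  box_nbhs_filter box_nbhs_singleton box_nbhs_nbhs.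

Lemma nbhs_box (x : finseq K) r : (forall k, 0 < r k) -> nbhs x (box x r).
Proof. by move=> r0; exists r. Qed.

Lemma finseq_add_continuous : continuous (fun x : finseq K * finseq K => x.1 + x.2).
Proof.
move=> [x y] U /= [r r0 rU].
have r20 k : 0 < r k / 2 by rewrite divr_gt0.
exists (box x (fun k => r k / 2), box y (fun k => r k / 2)).
  by split; exact: nbhs_box.
move=> [x' y'] /= [xx yy]; apply: rU => k.
rewrite !coefD opprD addrACA (le_lt_trans (ler_normD _ _)) //.
by rewrite [r k]splitr ltrD.
Qed.

Lemma finseq_scale_continuous : continuous (fun z : K^o * finseq K => z.1 *: z.2).
Proof.
move=> [a x] U /= [r r0 rU].
(* The sum is finite because [x] has finite support. It gives [|x_k| <= s * (r k / 2)] for all [k]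
   at once, so that changing the scalar by less than [s^-1] costs at most half of each radius. The
   summand 1 ensures [s^-1 <= 1], hence [|b| <= |a| + 1]. *)
pose s := 1 + \sum_(k < size x) `|x`_k| * 2 / r k.
have s1 : 1 <= s by rewrite lerDl; apply: sumr_ge0 => k _; rewrite divr_ge0 ?mulr_ge0 // ltW.
have s0 : 0 < s by exact: lt_le_trans s1.
have xs k : `|x`_k| <= s * (r k / 2).
  have [kx|kx] := ltnP k (size x); last first.
    by rewrite nth_default // normr0 mulr_ge0 ?divr_ge0 // ltW.
  rewrite -ler_pdivrMr ?divr_gt0 // invf_div mulrA /s (bigD1 (Ordinal kx)) //= addrCA lerDl.
  by rewrite addr_ge0 //; apply: sumr_ge0 => i _; rewrite divr_ge0 ?mulr_ge0 // ltW.
pose t k := r k / (2 * (`|a| + 1)).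
have a1 : 0 < `|a| + 1 by rewrite ltr_wpDl.
have t0 k : 0 < t k by rewrite divr_gt0 ?mulr_gt0.
have si0 : 0 < s^-1 by rewrite invr_gt0.
exists (ball (a : K^o) s^-1, box x t).
  by split; [exact: nbhsx_ballx|exact: nbhs_box].
move=> [b y] /= [ab xy]; apply: rU => k.
rewrite !coefZ.
have -> : b * y`_k - a * x`_k = b * (y`_k - x`_k) + (b - a) * x`_k.
  by rewrite mulrBr mulrBl addrA subrK.
have ba : `|b - a| < s^-1 by rewrite distrC.
have b1 : `|b| <= `|a| + 1.
  rewrite -[b](subrK a) addrC (le_trans (ler_normD _ _)) // lerD2l.
  by apply: (le_trans (ltW ba)); rewrite invf_le1.
apply: le_lt_trans (ler_normD _ _) _; rewrite !normrM [ltRHS]splitr.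
apply: ltr_leD.
  apply: (@le_lt_trans _ _ ((`|a| + 1) * `|y`_k - x`_k|)); first by rewrite ler_wpM2r.
  by rewrite mulrC -ltr_pdivlMr // -mulrA -invfM.
apply: (@le_trans _ _ (s^-1 * (s * (r k / 2)))).
  by apply: ler_pM => //; exact: ltW.
by rewrite mulrA mulVf ?mul1r // gt_eqF.
Qed.

Local Open Scope convex_scope.

Lemma box_convex (x : finseq K) r : convex_set (box x r : set (convex_lmodType (finseq K))).
Proof.
apply/convex_setW => y z; rewrite !inE /= => yx zx l l0 l1; rewrite inE /= => k.
have l10 : 0 < 1 - l%:num by rewrite subr_gt0.
have l1E : l%:num + (1 - l%:num) = 1 by rewrite addrC subrK.
have -> : y <|l|> z = l%:num *: (y : finseq K) + (1 - l%:num) *: (z : finseq K) by [].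
rewrite coefD !coefZ.
have -> : l%:num * y`_k + (1 - l%:num) * z`_k - x`_k =
    l%:num * (y`_k - x`_k) + (1 - l%:num) * (z`_k - x`_k).
  by rewrite !mulrBr addrACA -opprD -mulrDl l1E mul1r.
apply: le_lt_trans (ler_normD _ _) _; rewrite !normrM (gtr0_norm l0) (gtr0_norm l10).
have -> : r k = l%:num * r k + (1 - l%:num) * r k by rewrite -mulrDl l1E mul1r.
by rewrite ltrD // ltr_pM2l.
Qed.

Lemma finseq_locally_convex : exists2 B : set_system (finseq K),
  (forall b, b \in B -> convex_set (b : set (convex_lmodType (finseq K)))) & basis B.
Proof.
exists [set B | exists x r, B = box x r].
  by move=> b; rewrite inE => -[x [r ->]]; exact: box_convex.
split.
  by move=> b [x [r ->]]; rewrite openE => y; exact: box_open.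
move=> x U [r r0 rU]; exists (box x r) => //; split; first by exists x, r.
exact: box_refl.
Qed.

(* [PreTopologicalLmod_isTvs] only provides the uniform structure. *)
HB.instance Definition _ := PreTopologicalLmod_isTvs.Build K (finseq K)
  finseq_add_continuous finseq_scale_continuous finseq_locally_convex.
HB.instance Definition _ := PreTopologicalNmodule_isTopologicalNmodule.Build (finseq K)
  finseq_add_continuous.
HB.instance Definition _ := TopologicalNmodule_isTopologicalLmodule.Build K (finseq K)
  finseq_scale_continuous.
HB.instance Definition _ := Uniform_isTvs.Build K (finseq K) finseq_locally_convex.

End finseq_topology.

Section tvs_linear.
Variables (K : numFieldType) (E F : tvsType K).

Lemma linear_continuous0 (f : {linear E -> F}) :
  (forall U, nbhs (0 : F) U -> nbhs (0 : E) (f @^-1` U)) -> continuous f.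
Proof.
move=> f0 x U Ux.
have := nbhsB (- f x) Ux; rewrite addNr => /f0 /(nbhsT x).
apply: filterS => _ [z [y Uy fz] <-] /=.
by rewrite raddfD /= -fz addrA subrr add0r.
Qed.

Lemma tvs_scalel_continuous (v : E) : continuous (fun c : K^o => c *: v).
Proof.
by move=> c; apply: (cvg_comp2 cvg_id (cvg_cst _) (@scale_continuous K E (_, _))).
Qed.

End tvs_linear.

Section midpoint_convexity.
Local Open Scope convex_scope.

Lemma convex_midpoint (K : numFieldType) (E : lmodType K) (b : set E) (x y : E) :
  convex_set (b : set (convex_lmodType E)) -> b x -> b y -> b (2^-1 *: (x + y)).
Proof.
move=> cb bx byy.
have half01 : 0 <= (2^-1 : K) <= 1 by rewrite invr_ge0 ler0n /= invf_le1 ?ltr0n // ler1n.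
pose l : {i01 K} := Itv01 (proj1 (andP half01)) (proj2 (andP half01)).
have /set_mem := cb x y l (mem_set bx) (mem_set byy).
have -> : ((x : convex_lmodType E) <| l |> y) = 2^-1 *: x + (1 - 2^-1) *: y by [].
have -> : 1 - 2^-1 = 2^-1 :> K by rewrite [X in X - _](splitr 1) div1r addrK.
by rewrite -scalerDr.
Qed.

End midpoint_convexity.

(* With weights 2^-(k+1), midpoint convexity replaces general convex combinations. *)
Lemma convex_dyadic_sum (K : numFieldType) (E : lmodType K) (b : set E) n (v : nat -> E) :
  convex_set (b : set (convex_lmodType E)) -> b 0 -> (forall k, b (v k)) ->
  b (\sum_(k < n) (2^-1) ^+ k.+1 *: v k).
Proof.
move=> cb b0; elim: n v => [|n IH] v bv; first by rewrite big_ord0.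
rewrite big_ord_recl expr1.
have -> : \sum_(i < n) 2^-1 ^+ (lift ord0 i).+1 *: v (lift ord0 i) =
    2^-1 *: \sum_(i < n) 2^-1 ^+ i.+1 *: v i.+1.
  by rewrite scaler_sumr; apply: eq_bigr => i _; rewrite scalerA -exprS.
by rewrite -scalerDr; apply: convex_midpoint => //; apply: (IH (fun k => v k.+1)).
Qed.

Lemma dyadic_sum_le1 (K : numFieldType) n : \sum_(k < n) (2^-1 : K) ^+ k.+1 <= 1.
Proof.
suff -> : \sum_(k < n) (2^-1 : K) ^+ k.+1 = 1 - 2^-1 ^+ n.
  by rewrite lerBlDr lerDl exprn_ge0 // invr_ge0.
elim: n => [|n IH]; first by rewrite big_ord0 expr0 subrr.
rewrite big_ord_recr /= IH.
have {1}-> : 2^-1 ^+ n = 2^-1 ^+ n.+1 + 2^-1 ^+ n.+1 :> K.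
  by rewrite exprS -mulrDl -[2^-1]div1r -splitr !mul1r.
by rewrite opprD addrA subrK.
Qed.

(** * Automatic continuity and completeness for finite sequences *)

Section finseq_linear.
Variable K : numFieldType.

Lemma finseqE (x : finseq K) n : (size x <= n)%N ->
  x = \sum_(k < n) x`_k *: ('X^k : finseq K).
Proof.
move=> xn; rewrite -poly_def; apply/polyP => k; rewrite coef_poly.
by case: ltnP => // nk; rewrite nth_default // (leq_trans xn).
Qed.

(** Inside a convex neighbourhood [b] of 0, the radius [r k] is chosen so that [x_k *: v k] stays in
    [b]; then [f x] is a dyadic combination of points of [b], whatever the length of [x]. *)
Lemma finseq_linear_continuous (E : tvsType K) (f : {linear finseq K -> E}) :
  continuous f.
Proof.
apply: linear_continuous0 => U U0.
have [B Bc [Bo Bb]] := @locally_convex K E.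
have [b [Bb' b0] bU] := Bb 0 U U0.
have cb : convex_set (b : set (convex_lmodType E)) by apply: Bc; rewrite inE.
(* The factor [2 ^+ k.+1] cancels the weight of index [k] in [convex_dyadic_sum]. *)
pose v k : E := 2 ^+ k.+1 *: f ('X^k : finseq K).
have small k : exists r : K, 0 < r /\ forall c : K, `|c| < r -> b (c *: v k).
  have := @tvs_scalel_continuous K E (v k) 0 b; rewrite scale0r.
  move=> /(_ (open_nbhs_nbhs (conj (Bo _ Bb') b0))).
  move=> /nbhs_ballP [r /= r0 rb]; exists r; split => // c cr; apply: rb.
  by rewrite -ball_normE /= sub0r normrN.
have [r rP] := choice small.
exists r => [k|x xr]; first by have [] := rP k.
apply: bU; rewrite (finseqE (leqnn (size x))) raddf_sum /=.
rewrite (eq_bigr (fun k : 'I_(size x) => (2^-1) ^+ k.+1 *: (x`_k *: v k))).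
  apply: (@convex_dyadic_sum K E b _ (fun k => x`_k *: v k)) => // k.
  by apply: (rP k).2; have := xr k; rewrite coef0 subr0.
move=> k _; rewrite linearZ /= /v !scalerA mulrAC -exprMn mulVf ?pnatr_eq0 //.
by rewrite expr1n mul1r.
Qed.

Lemma seminorm_sum (E : lmodType K) (p : E -> K) n (c : nat -> K) (e : nat -> E) :
  seminorm p -> p (\sum_(k < n) c k *: e k) <= \sum_(k < n) `|c k| * p (e k).
Proof.
case=> p0 pZ pD; elim: n => [|n IH].
  by rewrite !big_ord0 -(scale0r 0) pZ normr0 mul0r.
by rewrite !big_ord_recr /= (le_trans (pD _ _)) // pZ lerD.
Qed.

Lemma finseq_seminorm_le (p : finseq K -> K) (x : finseq K) n : seminorm p ->
  (size x <= n)%N -> p x <= \sum_(k < n) `|x`_k| * p ('X^k : finseq K).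
Proof.
by move=> sp xn; rewrite {1}(finseqE xn); apply: (seminorm_sum n (fun k => x`_k)).
Qed.

Lemma finseq_seminorm_continuous (p : finseq K -> K) : seminorm p -> continuous p.
Proof.
move=> sp; have [p0 pZ pD] := sp.
have pN y : p (- y) = p y by rewrite -scaleN1r pZ normrN1 mul1r.
have pB x y : `|p x - p y| <= p (x - y).
  have a1 := pD (x - y) y; rewrite subrK in a1.
  have a2 := pD (y - x) x; rewrite subrK -opprB pN in a2.
  rewrite real_ler_norml ?realB ?ger0_real //.
  by rewrite lerBlDr a1 andbT lerNl opprB lerBlDr a2.
move=> x; apply/(@cvgrPdist_le _ _ _ (nbhs x) (nbhs_filter x)) => e e0.
(* Adding 1 allows the division when [p] vanishes on a unit vector. With the radii below, coordinate
   [k] contributes at most [e * 2^-1 ^+ k.+1], and these contributions add up to at most [e]. *)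
have pp k : 0 < p ('X^k : finseq K) + 1 by rewrite ltr_wpDl.
exists (fun k => e * 2^-1 ^+ k.+1 / (p ('X^k : finseq K) + 1)).
  by move=> k; rewrite divr_gt0 // mulr_gt0 // exprn_gt0 // invr_gt0.
move=> y yx /=; rewrite distrC; apply: (le_trans (pB _ _)).
apply: (le_trans (finseq_seminorm_le sp (leqnn _))).
apply: (@le_trans _ _ (e * \sum_(k < size (y - x)%R) 2^-1 ^+ k.+1)).
  rewrite mulr_sumr; apply: ler_sum => k _; rewrite coefB.
  apply: (@le_trans _ _ (`|y`_k - x`_k| * (p ('X^k : finseq K) + 1))).
    by rewrite ler_wpM2l // lerDl.
  by rewrite -ler_pdivlMr // ltW.
by rewrite -[leRHS]mulr1 ler_pM2l // dyadic_sum_le1.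
Qed.

Lemma finseq_complete :
  (forall F : set_system K, ProperFilter F -> cauchy F -> exists l : K, F --> l) ->
  complete_tvs (finseq K).
Proof.
move=> Kc F FF Fc.
have small (r : nat -> K) : (forall k, 0 < r k) ->
    exists2 A, F A & forall x y, A x -> A y -> forall k, `|x`_k - y`_k| < r k.
  move=> r0; have [[A B] /= [FA FB] AB] := Fc _ (nbhs_box 0 r0).
  exists (A `&` B) => [|x y [Ax _] [_ By] k]; first exact: filterI.
  by have /(_ k) := AB (x, y) (conj Ax By); rewrite /= coefB coef0 subr0.
have coordF k : exists l : K, (fun x : finseq K => x`_k) @ F --> l.
  apply: Kc; apply/cauchyP => e e0.
  have [A FA Ae] := small (fun=> e) (fun=> e0).
  have [x Ax] := filter_ex FA.
  exists x`_k; rewrite -ball_normE /=; apply: (filterS _ FA) => y Ay; exact: (Ae x y Ax Ay k).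
have [l lP] := choice coordF.
have lim_le A x r k : F A -> (forall y, A y -> `|y`_k - x`_k| < r) -> `|l k - x`_k| <= r.
  move=> FA Ar; apply: (cvg_norm_le (lP k)).
  by apply: filterS FA => y /Ar /ltW.
have [n ln] : exists n, forall k, (n <= k)%N -> l k = 0.
  (* The value 1 only keeps the radius positive. At an index past [size x] the coordinate of [x] is
     0, and closeness to the limit would give [|l k| <= |l k| / 2], which forces [l k = 0]. *)
  pose r k := if l k == 0 then 1 else `|l k| / 2.
  have r0 k : 0 < r k.
    by rewrite /r; case: eqVneq => // lk; rewrite divr_gt0 // normr_gt0.
  have [A FA Ar] := small r r0; have [x Ax] := filter_ex FA.
  exists (size x) => k xk; apply/eqP; apply: contrapT => /negP lk.
  have := lim_le A x (r k) k FA (fun y Ay => Ar y x Ay Ax k).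
  rewrite nth_default // subr0 /r (negbTE lk) ler_pdivlMr // mulr_natr mulr2n.
  by rewrite gerDl normr_le0 (negbTE lk).
pose L : finseq K := \poly_(k < n) l k.
have LE k : L`_k = l k by rewrite coef_poly; case: ltnP => // /ln.
exists L => U [r r0 rU].
(* The radii are halved because the limit turns strict inequalities into large ones, while a box is
   defined by strict ones. *)
have [A FA Ar] := small (fun k => r k / 2) (fun k => divr_gt0 (r0 k) (ltr0n _ 2)).
apply: (filterS _ FA) => x Ax; apply: rU => k; rewrite distrC LE.
apply: (@le_lt_trans _ _ (r k / 2)).
  by apply: (lim_le A _ _ _ FA) => y Ay; exact: (Ar y x Ay Ax k).
by rewrite ltr_pdivrMr // mulr_natr mulr2n ltrDl.
Qed.

End finseq_linear.

(** * Extension of functionals and nuclearity *)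

Section dense_extension.
Variables (K : numFieldType) (E : lmodType K) (B : normedModType K).
Hypothesis Kc : forall F : set_system K, ProperFilter F -> cauchy F -> exists l : K, F --> l.

Lemma dense_norm_approx (D : set B) (z : B) (e : K) : dense D -> 0 < e ->
  exists2 y, D y & `|z - y| < e.
Proof.
move=> dD e0; have [|y [zy Dy]] := dD (ball z e) _ (ball_open _ _).
  by exists z; exact: ballxx.
by exists y => //; rewrite -ball_normE in zy.
Qed.

(* The value at z is the l such that |l - phi x| <= |z - pi x| for all x. *)
Lemma functional_dense_extension (pi : {linear E -> B}) (phi : {linear E -> K^o}) :
  dense (range pi) -> (forall x, `|phi x| <= `|pi x|) ->
  exists f : {linear B -> K^o}, (forall x, f (pi x) = phi x) /\ (forall z, `|f z| <= `|z|).
Proof.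
move=> dpi phile.
have ext z : exists l : K, forall x, `|l - phi x| <= `|z - pi x|.
  (* The trace on [E] of the neighbourhoods of [z]; it is proper because [pi] has dense range, and
     [phi] is Cauchy along it because [phi] is dominated by the norm of [pi]. *)
  pose G : set_system E := filter_from (nbhs z) (fun U => pi @^-1` U).
  have GF : Filter G.
    apply: filter_from_filter; first by exists setT; exact: filterT.
    by move=> U V Uz Vz; exists (U `&` V) => //; exact: filterI.
  have PG : ProperFilter G.
    apply: filter_from_proper => U /nbhs_ballP[e /= e0 zU].
    have [y [x _ <-] zx] := dense_norm_approx z dpi e0.
    by exists x; apply: zU; rewrite -ball_normE.
  have near_z e : 0 < e -> G [set x | `|z - pi x| < e].
    move=> e0; exists (ball z e); first exact: nbhsx_ballx.
    by move=> x; rewrite -ball_normE.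
  have phiB x y : `|phi x - phi y| <= `|z - pi x| + `|z - pi y|.
    rewrite -raddfB (le_trans (phile _)) // raddfB.
    have -> : pi x - pi y = (z - pi y) - (z - pi x) by rewrite opprB [RHS]addrC addrA subrK.
    by rewrite (le_trans (ler_normB _ _)) // addrC.
  have [|l Gl] := Kc (F := (phi : E -> K) @ G).
    apply/cauchyP => e e0.
    have G2 := near_z (e / 2) (divr_gt0 e0 (ltr0n _ 2)).
    have [x zx] := filter_ex G2.
    exists (phi x); rewrite -ball_normE /=; apply: (filterS _ G2) => y zy /=.
    by apply: (le_lt_trans (phiB x y)); rewrite [e]splitr ltrD.
  exists l => x; apply/ler_addgt0Pl => e e0.
  apply: (@cvg_norm_le K K^o _ G PG phi l (phi x) _ Gl).
  apply: (filterS _ (near_z e e0)) => y zy /=.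
  by apply: (le_trans (phiB y x)); rewrite lerD2r ltW.
have [f fP] := choice ext.
have f_lin : linear (f : B -> K^o).
  move=> a z z'; apply/eqP; rewrite -subr_eq0 -normr_le0; apply/ler_addgt0Pl => e e0.
  (* Dividing by [|a| + 1] covers the case [a = 0]. The two approximations contribute [e / 4] each,
     twice: once through [f (a *: z + z')] and once through [f z] and [f z']. *)
  have a1 : 0 < `|a| + 1 by rewrite ltr_wpDl.
  have e4 : 0 < e / 4 by rewrite divr_gt0.
  have [_ [x _ <-] zx] := dense_norm_approx z dpi (divr_gt0 e4 a1).
  have [_ [x' _ <-] zx'] := dense_norm_approx z' dpi e4.
  have azx : `|a| * `|z - pi x| <= e / 4.
    apply: (@le_trans _ _ ((`|a| + 1) * `|z - pi x|)); first by rewrite ler_wpM2r // lerDl.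
    by rewrite mulrC -ler_pdivlMr // ltW.
  have h1 := fP (a *: z + z') (a *: x + x').
  have h2 := fP z x; have h3 := fP z' x'.
  have hz : `|a *: z + z' - pi (a *: x + x')| <= e / 4 + e / 4.
    rewrite linearP opprD addrACA -scalerBr (le_trans (ler_normD _ _)) // normrZ.
    by rewrite lerD // ltW.
  have phiE : phi (a *: x + x') = a * phi x + phi x' := linearP phi a x x'.
  have -> : f (a *: z + z') - (a *: f z + f z' : K^o) =
      (f (a *: z + z') - phi (a *: x + x')) - (a * (f z - phi x) + (f z' - phi x')).
    rewrite phiE; move: (f _) (f z) (f z') (phi x) (phi x') => u1 u2 u3 u4 u5.
    change (u1 - (a * u2 + u3) = u1 - (a * u4 + u5) - (a * (u2 - u4) + (u3 - u5))); ring.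
  apply: (le_trans (ler_normB _ _)).
  have -> : e + 0 = (e / 4 + e / 4) + (e / 4 + e / 4) by rewrite addr0; field.
  apply: lerD; first exact: le_trans h1 hz.
  apply: (le_trans (ler_normD _ _)); rewrite normrM lerD //.
    by rewrite (le_trans _ azx) // ler_wpM2l.
  by rewrite (le_trans h3) // ltW.
pose fM := GRing.isLinear.Build K B K^o *:%R f f_lin.
pose g : {linear B -> K^o} := HB.pack f fM.
exists g; split => [x|z].
  (* The defining inequality at [z = pi x] shows that [f] extends [phi]; at [x = 0] it is the norm
     bound. *)
  apply/eqP; rewrite -subr_eq0 -normr_le0; have := fP (pi x) x.
  by rewrite subrr normr0.
by have := fP z 0; rewrite (raddf0 phi) (raddf0 pi) !subr0.
Qed.

End dense_extension.

(** * Weighted l^1 norms and nuclearity of the space of finite sequences *)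

Section weighted_norm.
Variable K : numFieldType.

Definition weighted_norm (w : nat -> K) (x : finseq K) : K :=
  \sum_(k < size x) w k * `|x`_k|.

Lemma weighted_normE (w : nat -> K) (x : finseq K) n : (size x <= n)%N ->
  weighted_norm w x = \sum_(k < n) w k * `|x`_k|.
Proof.
move=> xn; rewrite /weighted_norm -!(big_mkord xpredT (fun k => w k * `|x`_k|)).
rewrite (big_cat_nat _ xn) //= [X in _ + X]big_nat_cond [X in _ + X]big1 ?addr0 //.
by move=> k /andP[/andP[xk _] _]; rewrite nth_default // normr0 mulr0.
Qed.

Lemma weighted_norm_seminorm (w : nat -> K) : (forall k, 0 <= w k) ->
  seminorm (weighted_norm w).
Proof.
move=> w0; split.
- by move=> x; apply: sumr_ge0 => k _; rewrite mulr_ge0.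
- move=> a x; rewrite (weighted_normE _ (size_scale_leq a x)) /weighted_norm mulr_sumr.
  by apply: eq_bigr => k _; rewrite coefZ normrM mulrCA.
- move=> x y; pose n := maxn (size x) (size y).
  rewrite (weighted_normE _ (size_polyD x y)) (weighted_normE _ (leq_maxl (size x) (size y))).
  rewrite (weighted_normE _ (leq_maxr (size x) (size y))) -big_split /=.
  by apply: ler_sum => k _; rewrite coefD -mulrDr ler_wpM2l // ler_normD.
Qed.

Lemma weighted_norm_coef_le (w : nat -> K) (x : finseq K) k : (forall k, 0 <= w k) ->
  w k * `|x`_k| <= weighted_norm w x.
Proof.
move=> w0; have [kx|kx] := ltnP k (size x).
  rewrite /weighted_norm (bigD1 (Ordinal kx)) //= lerDl.
  by apply: sumr_ge0 => i _; rewrite mulr_ge0.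
rewrite nth_default // normr0 mulr0; apply: sumr_ge0 => i _; exact: mulr_ge0.
Qed.

End weighted_norm.

Lemma cvg_dyadic_series (R : realType) :
  cvgn (series (fun n => `|(2^-1 : (R[i] : numFieldType)) ^+ n|)).
Proof.
have h : `|2^-1 : R| < 1 by rewrite ger0_norm ?invr_ge0 // invf_lt1 // ltr1n.
have := @is_cvg_geometric_series R 1 2^-1 h => /cvg_ex[l hl].
apply/cvg_ex; exists (l%:C%C).
rewrite (_ : series _ = (fun x : R => x%:C%C : (R[i] : numFieldType)) \o series (geometric 1 2^-1)).
  by apply: continuous_cvg => //; exact: real_complex_continuous.
apply/funext => n; rewrite /series /= rmorph_sum /=; apply: eq_bigr => k _.
by rewrite mul1r ger0_norm ?exprn_ge0 ?invr_ge0 // rmorphXn /= fmorphV rmorph_nat.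
Qed.

Lemma finseq_nuclear (R : realType) : nuclear_space (finseq R[i]).
Proof.
move=> p sp _; have [p0 pZ pD] := sp.
pose e k : finseq (R[i] : numFieldType) := 'X^k.
pose m k := p (e k) + 1.
have m0 k : 0 < m k by rewrite ltr_wpDl.
pose w k := 2 ^+ k * m k.
have w0 k : 0 <= w k by rewrite mulr_ge0 ?exprn_ge0 // ltW.
exists (weighted_norm w); split.
- exact: weighted_norm_seminorm.
- exact/finseq_seminorm_continuous/weighted_norm_seminorm.
- move=> x; apply: (le_trans (finseq_seminorm_le sp (leqnn _))).
  apply: ler_sum => k _; rewrite mulrC ler_wpM2r // /w.
  apply: (@le_trans _ _ (m k)); first by rewrite lerDl.
  by rewrite ler_peMl ?exprn_ege1 ?ler1n // ltW.
move=> Bq Bp piq pip u [piqN piqD] [pipN pipD] uc upi.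
have coordL k : linear (fun x : finseq R[i] => w k * x`_k : (R[i])^o).
  by move=> a x y /=; rewrite coefD coefZ mulrDr mulrCA.
pose phi k : {linear finseq R[i] -> (R[i])^o} :=
  HB.pack (fun x : finseq R[i] => w k * x`_k : (R[i])^o)
    (GRing.isLinear.Build _ _ _ *:%R _ (coordL k)).
(* A weighted coordinate is at most the weighted norm, so [phi k] extends to [Bq] as a functional of
   norm at most 1. *)
have phile k x : `|phi k x| <= `|piq x|.
  by rewrite piqN normrM (ger0_norm (w0 k)) weighted_norm_coef_le.
have ext k := functional_dense_extension (@complex_complete R) piqD (phile k).
have [f fP] := choice ext.
pose y k := (m k)^-1 *: pip (e k).
have y1 k : `|y k| <= 1.
  by rewrite normrZ pipN gtr0_norm ?invr_gt0 // mulrC ler_pdivrMr // mul1r lerDl.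
exists (fun n => 2^-1 ^+ n), f, y; split.
- exact: cvg_dyadic_series.
- by exists 1 => n x; rewrite mul1r; exact: (fP n).2.
- by exists 1.
move=> z.
(* The operators [T n] are uniformly bounded and agree with [u] on [piq x] once [size x <= n];
   density of these vectors and continuity of [u] then give convergence at every [z]. *)
pose T n z' : Bp := \sum_(k < n) (2^-1 ^+ k * f k z') *: y k.
have TB n z1 z2 : T n z1 - T n z2 = T n (z1 - z2).
  by rewrite /T -sumrB; apply: eq_bigr => k _; rewrite -scalerBl -mulrBr raddfB.
(* The factor 2 turns [2^-1 ^+ k] into [2^-1 ^+ k.+1], whose partial sums are at most 1. *)
have T_le n z' : `|T n z'| <= 2 * `|z'|.
  apply: (le_trans (ler_norm_sum _ _ _)).
  apply: (@le_trans _ _ (\sum_(k < n) (2 * `|z'|) * 2^-1 ^+ k.+1)); last first.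
    by rewrite -mulr_sumr -[leRHS]mulr1 ler_wpM2l ?mulr_ge0 // dyadic_sum_le1.
  apply: ler_sum => k _; rewrite normrZ normrM ger0_norm ?exprn_ge0 ?invr_ge0 //.
  apply: (@le_trans _ _ (2^-1 ^+ k * `|z'| * 1)).
    apply: ler_pM => //; last exact: y1.
    by apply: ler_wpM2l; [rewrite exprn_ge0 ?invr_ge0|exact: (fP k).2].
  by rewrite mulr1 exprS mulrA [2 * _]mulrC mulfK ?pnatr_eq0 // mulrC.
have Tpi n (x : finseq R[i]) : (size x <= n)%N -> T n (piq x) = u (piq x).
  move=> xn; rewrite upi {2}(finseqE xn) raddf_sum /T; apply: eq_bigr => k _.
  rewrite [RHS]linearZ /= (fP k).1 /= /y scalerA; congr (_ *: _).
  have hk : 2^-1 ^+ k * 2 ^+ k = 1 :> R[i] by rewrite -exprMn mulVf ?expr1n ?pnatr_eq0.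
  have mk : m k / m k = 1 by rewrite divff // gt_eqF.
  transitivity ((2^-1 ^+ k * 2 ^+ k) * (m k / m k) * x`_k); last by rewrite hk mk !mul1r.
  by rewrite /w; move: (2^-1 ^+ k) (2 ^+ k) (m k) (m k)^-1 x`_k => a b c d t; ring.
have -> : series (fun n => (2^-1 ^+ n * f n z) *: y n) = T ^~ z.
  by apply/funext => n; rewrite /series /= big_mkord.
apply/cvgrPdist_le => eps eps0.
have e2 : 0 < eps / 2 by rewrite divr_gt0.
have e4 : 0 < eps / 4 by rewrite divr_gt0.
have : nbhs z [set t | `|u z - u t| <= eps / 2].
  exact: (@cvgr_dist_le _ _ _ (nbhs z) _ u (u z) (uc z) _ e2).
move=> /nbhs_ballP[d /= d0 dP].
(* A tolerance below both [d], for the continuity of [u], and [eps / 4], for the bound on [T n]. *)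
have dd0 : 0 < d * (eps / 4) / (d + eps / 4) by rewrite !(divr_gt0, mulr_gt0, addr_gt0).
have [_ [x _ <-] zx] := dense_norm_approx z piqD dd0.
have de0 : 0 < d + eps / 4 by rewrite addr_gt0 // divr_gt0.
have zxd : `|z - piq x| < d.
  by apply: lt_le_trans zx _; rewrite ler_pdivrMr // ler_pM2l // lerDr ltW.
have zxe : `|z - piq x| < eps / 4.
  by apply: lt_le_trans zx _; rewrite ler_pdivrMr // mulrC ler_pM2l // lerDl ltW.
exists (size x) => // n /= xn.
have -> : u z - T n z = (u z - u (piq x)) + T n (piq x - z).
  by rewrite -TB Tpi // addrA subrK.
apply: (le_trans (ler_normD _ _)); rewrite [eps]splitr lerD //.
  by apply: dP; rewrite -ball_normE.
apply: (le_trans (T_le _ _)); rewrite distrC.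
have -> : eps / 2 = 2 * (eps / 4) by field.
by rewrite ler_pM2l // ltW.
Qed.

(** * Linearly independent sequences and orthogonal projections *)

Section free_sequences.
Variables (K : fieldType) (V : lmodType K).

Definition in_span (b : nat -> V) (n : nat) (v : V) : Prop :=
  exists c : nat -> K, v = \sum_(i < n) c i *: b i.

Definition free_sequence (b : nat -> V) : Prop :=
  forall n (c : nat -> K), \sum_(i < n) c i *: b i = 0 ->
  forall i, (i < n)%N -> c i = 0.

Lemma in_span_lin b n (a : K) v w : in_span b n v -> in_span b n w -> in_span b n (a *: v + w).
Proof.
move=> [c ->] [d ->]; exists (fun i => a * c i + d i).
by rewrite scaler_sumr -big_split; apply: eq_bigr => i _; rewrite scalerDl scalerA.
Qed.

Lemma in_span0 b n : in_span b n 0.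
Proof. by exists (fun=> 0); rewrite big1 // => i _; rewrite scale0r. Qed.

Lemma in_span_gen b n i : (i < n)%N -> in_span b n (b i).
Proof.
move=> ni; exists (fun k => (k == i)%:R); rewrite (bigD1 (Ordinal ni)) //= eqxx scale1r.
rewrite big1 ?addr0 // => k ki; rewrite (_ : (k == i :> nat) = false) ?scale0r //.
by apply/negbTE; apply: contraNneq ki => e; apply/eqP/val_inj.
Qed.

Lemma in_span_sum b n (I : Type) (r : seq I) (c : I -> K) (v : I -> V) :
  (forall i, in_span b n (v i)) -> in_span b n (\sum_(i <- r) c i *: v i).
Proof.
move=> bv; elim: r => [|i r IH]; first by rewrite big_nil; exact: in_span0.
by rewrite big_cons; apply: in_span_lin.
Qed.

Lemma in_spanS b n m v : (n <= m)%N -> in_span b n v -> in_span b m v.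
Proof.
move=> nm [c ->]; apply: in_span_sum => i; apply: in_span_gen.
exact: leq_trans (ltn_ord i) nm.
Qed.

Lemma eq_in_span b b' n v : (forall i, (i < n)%N -> b i = b' i) -> in_span b n v -> in_span b' n v.
Proof. by move=> bb' [c ->]; exists c; apply: eq_bigr => i _; rewrite bb'. Qed.

(* b n is the first x m outside the span of b 0, ..., b (n - 1). *)
Lemma free_extraction (x : nat -> V) :
  (forall b n, exists m, ~ in_span b n (x m)) ->
  exists b, free_sequence b /\ forall m, in_span b m.+1 (x m).
Proof.
move=> nspan.
have ex (b : nat -> V) n : exists m, `[< ~ in_span b n (x m) >].
  by have [m bm] := nspan b n; exists m; apply/asboolP.
pose step (s : seq V) := rcons s (x (ex_minn (ex (nth 0 s) (size s)))).
pose s n := iter n step [::].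
have ss n : size (s n) = n by elim: n => //= n IH; rewrite size_rcons IH.
(* The list grows only at its end, so its entry [n] is final from stage [n.+1] on. *)
pose b n := nth 0 (s n.+1) n.
have sb n i : (i < n)%N -> nth 0 (s n) i = b i.
  elim: n => // n IH; rewrite ltnS leq_eqVlt => /predU1P[->//|ni].
  by rewrite /= nth_rcons ss ni IH.
have bP n : exists m, [/\ b n = x m, ~ in_span b n (x m) &
    forall k, ~ in_span b n (x k) -> (m <= k)%N].
  rewrite /b /= nth_rcons ss ltnn eqxx; case: ex_minnP => m /asboolP sm mmin.
  exists m; split => //.
    by move=> bm; apply: sm; apply: eq_in_span bm => i ni; rewrite sb.
  move=> k bk; apply: mmin; apply/asboolP => sk; apply: bk.
  by apply: eq_in_span sk => i; exact: sb.
exists b; split.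
  elim=> // n IH c; rewrite big_ord_recr /= => c0.
  have cn : c n = 0.
    apply/eqP; apply: contrapT => /negP cn.
    have [m [bm nm _]] := bP n; apply: nm; rewrite -bm.
    exists (fun i => - (c n)^-1 * c i).
    under eq_bigr do rewrite -scalerA.
    by rewrite -scaler_sumr scaleNr -scalerN (addr0_eq c0) scalerA mulVf // scale1r.
  move=> i; rewrite ltnS leq_eqVlt => /predU1P[->//|]; apply: IH.
  by rewrite cn scale0r addr0 in c0.
(* If [x n] is not yet in the span, the first index [m] chosen at stage [n] satisfies [m <= n]; by
   induction it cannot be smaller, so [b n] is [x n] itself. *)
suff H n : forall k, (k < n)%N -> in_span b n (x k) by move=> m; exact: H.
elim: n => // n IH k; rewrite ltnS leq_eqVlt => /predU1P[->|kn]; last first.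
  by apply: in_spanS (IH _ kn).
have [xn|xn] := pselect (in_span b n (x n)); first exact: in_spanS xn.
have [m [bm nm mmin]] := bP n.
have := mmin n xn; rewrite leq_eqVlt => /predU1P[mn|/IH //].
by rewrite -mn -bm mn; exact: in_span_gen.
Qed.

End free_sequences.

Section gram_schmidt.
Variables (R : realType) (H : hilbertType R).

Definition hproj (t : seq H) (x : H) : H := \sum_(e <- t) inner x e *: e.

Lemma hproj_is_linear t : linear (hproj t).
Proof.
move=> a x y; rewrite /hproj scaler_sumr -big_split; apply: eq_bigr => e _ /=.
by rewrite linearPl /= scalerDl scalerA.
Qed.

HB.instance Definition _ t := GRing.isLinear.Build R[i] H H *:%R (hproj t) (hproj_is_linear t).

Lemma hprojZ t (a : R[i]) x : hproj t (a *: x) = a *: hproj t x.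
Proof. exact: linearZ. Qed.

Lemma inner_le (x y : H) : `|inner x y| <= `|x| * `|y| :> R[i].
Proof.
apply: (le_trans (dot_cauchy_schwarz inner x y)).
by rewrite !inner_norm !sqrCK.
Qed.

Lemma hproj_le t (x : H) : `|hproj t x| <= (\sum_(e <- t) `|e| ^+ 2) * `|x| :> R[i].
Proof.
apply: (le_trans (ler_norm_sum _ _ _)); rewrite mulr_suml; apply: ler_sum => e _.
by rewrite normrZ mulrC expr2 -mulrA ler_wpM2l // mulrC inner_le.
Qed.

Lemma inner_hproj t (x f : H) : inner (hproj t x) f = \sum_(e <- t) inner x e * inner e f :> R[i].
Proof.
elim: t => [|e t IH]; rewrite /hproj ?big_nil ?linear0l // !big_cons.
by rewrite linearDl /= linearZl_LR /= -IH.
Qed.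

(* The orthogonality of the residuals to t is used in place of the orthonormality of t. *)
Lemma gram_schmidt (n : nat) (v : 'I_n -> H) :
  exists t : seq H, (forall i, hproj t (v i) = v i) /\
    forall x e, e \in t -> inner (x - hproj t x) e = 0 :> R[i].
Proof.
elim: n v => [|n IH] v; first by exists [::]; split => // -[].
(* The family without its first vector is treated first. The residual [r] of [v ord0] is then either
   zero, and [t] already works, or it is normalized and added to [t]. *)
have [t [tv tx]] := IH (fun i => v (lift ord0 i)).
pose r := v ord0 - hproj t (v ord0).
have [r0|r0] := eqVneq r 0.
  exists t; split => // i; have [j ->|->] := unliftP ord0 i; first exact: tv.
  by apply/eqP; rewrite eq_sym -subr_eq0; apply/eqP.
have nr0 : 0 < `|r| :> R[i] by rewrite normr_gt0.
pose e := `|r|^-1 *: r.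
have ee : inner e e = 1 :> R[i].
  by rewrite inner_norm normfZV // expr1n.
have et f : f \in t -> inner e f = 0 :> R[i].
  by move=> ft; rewrite linearZl_LR /= tx // mulr0.
have te x : inner (hproj t x) e = 0 :> R[i].
  rewrite inner_hproj big_seq big1 // => f ft.
  have fe : inner f e = 0 :> R[i] by rewrite hermC /= et // rmorph0 mulr0.
  by rewrite fe mulr0.
exists (e :: t).
have projE x : hproj (e :: t) x = inner x e *: e + hproj t x by rewrite /hproj big_cons.
split.
  move=> i; rewrite projE; have [j ->|->] := unliftP ord0 i.
    by rewrite -{1}tv te scale0r add0r tv.
  have re : inner (v ord0) e = `|r| :> R[i].
    rewrite -[v ord0](subrK (hproj t (v ord0))) linearDl /= te addr0 -/r.
    by rewrite linearZr_LR /= inner_norm (@geC0_conj R[i]) ?invr_ge0 // expr2 mulKf ?gt_eqF.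
  by rewrite re scalerA divff ?gt_eqF // scale1r subrK.
move=> x f; rewrite projE inE opprD addrA addrAC => /predU1P[->|ft].
  by rewrite !linearBl /= linearZl_LR /= ee te mulr1 subr0 subrr.
by rewrite linearBl /= tx // linearZl_LR /= et // mulr0 subr0.
Qed.

Lemma finite_dimensional_hproj : finite_dimensional H -> exists t, forall x, hproj t x = x.
Proof.
case=> n [v vH]; have [t [tv _]] := gram_schmidt v; exists t => x.
have [c ->] := vH x; rewrite raddf_sum; apply: eq_bigr => i _.
by rewrite -[in RHS](tv i); exact: (hprojZ t (c i) (v i)).
Qed.

(** [hproj t] is bounded, so being the identity extends from [D] to its closure. This is how a
    finite-dimensional span containing a dense set is shown to be the whole space. *)
Lemma hproj_dense t (D : set H) : dense D -> (forall x, D x -> hproj t x = x) ->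
  forall x, hproj t x = x.
Proof.
move=> dD tD x; apply/eqP; rewrite -subr_eq0 -normr_le0; apply/ler_addgt0Pl => e e0.
(* The sum bounds [hproj t (x - y)], and the added 1 accounts for [x - y] itself. *)
pose M : R[i] := \sum_(e <- t) `|e| ^+ 2 + 1.
have M0 : 0 < M by rewrite ltr_wpDl // sumr_ge0 // => f _; rewrite exprn_ge0.
have [|y [xy Dy]] := dD (ball x (e / M)) _ (ball_open _ _).
  by exists x; apply: ballxx; rewrite divr_gt0.
rewrite -ball_normE /= in xy.
have -> : hproj t x - x = hproj t (x - y) - (x - y).
  by rewrite (raddfB (hproj t)) /= (tD y Dy) opprB addrA subrK.
apply: (le_trans (ler_normB _ _)); rewrite addr0.
apply: (@le_trans _ _ (M * `|x - y|)); first by rewrite mulrDl mul1r lerD2r hproj_le.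
by rewrite mulrC -ler_pdivlMr // ltW.
Qed.

Lemma inner_continuous (e : H) : continuous (fun x => inner x e : (R[i])^o).
Proof.
apply: (@lipschitz_continuous _ H (R[i])^o _ `|e|) => // x y.
by rewrite -[X in `|X|](linearBl inner) mulrC; exact: inner_le.
Qed.

(** A finite [t] with [hproj t] the identity makes [g] a finite sum of the fixed vectors [g e] with
    the continuous coefficients [inner x e]. *)
Lemma finite_dimensional_linear_continuous (E : tvsType R[i]) (g : {linear H -> E}) :
  finite_dimensional H -> continuous g.
Proof.
move=> /finite_dimensional_hproj[t tH].
have gZ (a : R[i]) y : g (a *: y) = a *: g y by exact: linearZ.
rewrite (_ : (g : H -> E) = fun x => \sum_(e <- t) (inner x e : (R[i])^o) *: g e); last first.
  apply/funext => x; rewrite -{1}[x]tH raddf_sum; apply: eq_bigr => e _.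
  exact: gZ.
apply: continuous_big; first exact: add_continuous.
move=> e _ x.
have H1 := @inner_continuous e x.
have H2 := @tvs_scalel_continuous _ E (g e) (inner x e).
refine (continuous_comp H1 H2).
Qed.

End gram_schmidt.

(** * Finite sequences and bases *)

Section finseq_lin.
Variables (K : numFieldType) (V : lmodType K) (b : nat -> V).

Definition finseq_lin (p : finseq K) : V := \sum_(k < size p) p`_k *: b k.

Lemma finseq_linE (p : finseq K) n : (size p <= n)%N ->
  finseq_lin p = \sum_(k < n) p`_k *: b k.
Proof.
move=> pn; rewrite /finseq_lin -!(big_mkord xpredT (fun k => p`_k *: b k)).
rewrite (big_cat_nat _ pn) //= [X in _ + X]big_nat_cond [X in _ + X]big1 ?addr0 //.
by move=> k /andP[/andP[xk _] _]; rewrite nth_default // scale0r.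
Qed.

Lemma finseq_lin_is_linear : linear finseq_lin.
Proof.
move=> a p q; pose n := maxn (size (a *: p + q)) (maxn (size p) (size q)).
rewrite (@finseq_linE (a *: p + q) n) ?leq_maxl // (@finseq_linE p n) ?(@finseq_linE q n);
  rewrite ?leq_max ?leqnn ?orbT //.
rewrite scaler_sumr -big_split; apply: eq_bigr => k _ /=.
by rewrite coefD coefZ scalerDl scalerA.
Qed.

HB.instance Definition _ := GRing.isLinear.Build K (finseq K) V *:%R
  finseq_lin finseq_lin_is_linear.

Lemma finseq_lin_poly n (c : nat -> K) :
  finseq_lin (\poly_(k < n) c k) = \sum_(k < n) c k *: b k.
Proof.
rewrite (finseq_linE (size_poly _ _)); apply: eq_bigr => k _.
by rewrite coef_poly ltn_ord.
Qed.

Lemma finseq_lin_inj : free_sequence b -> injective finseq_lin.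
Proof.
move=> bfree; apply: raddf_inj => p p0; apply/polyP => k; rewrite coef0.
have [kp|kp] := ltnP k (size p); last by rewrite nth_default.
exact: (bfree (size p) (fun k => p`_k)).
Qed.

End finseq_lin.

Section ell2_finseq.
Variables (R : realType) (A : pred nat).
Local Notation C := (R[i] : numFieldType).

Lemma finite_support_square_summable (u : nat -> C) N :
  (forall k, (N <= k)%N -> u k = 0) -> square_summable u.
Proof.
move=> uN; exists (series (fun k => `|u k| ^+ 2) N) => n.
apply: (@le_trans _ _ (series (fun k => `|u k| ^+ 2) (N + n))).
  rewrite /series /= (big_cat_nat _ (leq_addl N n)) //= lerDl.
  by apply: sumr_ge0 => k _; rewrite exprn_ge0.
rewrite /series /= (big_cat_nat _ (leq_addr n N)) //= [X in _ + X]big_nat_cond.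
rewrite [X in _ + X]big1 ?addr0 // => k /andP[/andP[Nk _] _].
by rewrite uN // normr0 expr0n.
Qed.

Lemma ell2_trunc_subproof (p : finseq R[i]) :
  (fun k => if A k then p`_k else 0) \in @ell2_pred R A.
Proof.
apply/asboolP; split; last by move=> k /negbTE->.
apply: (@finite_support_square_summable _ (size p)) => k pk.
by rewrite nth_default //; case: ifP.
Qed.

Definition ell2_of_finseq (p : finseq R[i]) : ell2 R A := Ell2 (ell2_trunc_subproof p).

Lemma ell2_of_finseqE p k : A k -> ell2_of_finseq p k = p`_k.
Proof. by move=> Ak; rewrite /= Ak. Qed.

Lemma ell2_of_finseq_is_linear : linear ell2_of_finseq.
Proof.
move=> a p q; apply: ell2_ext => k; rewrite ell2D ell2Z /=.
by case: (A k); rewrite ?mulr0 ?addr0 // coefD coefZ.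
Qed.

HB.instance Definition _ := GRing.isLinear.Build R[i] (finseq R[i]) (ell2 R A) *:%R
  ell2_of_finseq ell2_of_finseq_is_linear.

End ell2_finseq.

(** * Dimension of the spaces of square summable sequences *)

Section ell2_findim.
Variable R : realType.
Local Notation C := (R[i] : numFieldType).

Lemma ell2_finite_dimensional i : finite_dimensional (ell2 R (fun k => (k < i)%N)).
Proof.
exists i, (fun k => ell2_of_finseq _ ('X^k)) => u; exists (fun k => u k).
apply: ell2_ext => k; rewrite ell2_sum.
have [ki|ki] := ltnP k i; last first.
  rewrite ell2_supp -?leqNgt // big1 // => l _.
  by rewrite ell2Z /= ltnNge ki mulr0.
rewrite (eq_bigr (fun l : 'I_i => u l * (k == l)%:R)); last first.
  by move=> l _; rewrite ell2Z ell2_of_finseqE // coefXn.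
rewrite (bigD1 (Ordinal ki)) //= eqxx mulr1 big1 ?addr0 // => l lk.
rewrite (_ : (k == l) = false) ?mulr0 //.
by apply/negbTE; apply: contraNneq lk => e; apply/eqP/val_inj.
Qed.

Lemma exists_ker_row (K : fieldType) n (M : 'M[K]_(n.+1, n)) :
  exists2 v : 'rV[K]_n.+1, v != 0 & v *m M = 0.
Proof.
exists (nz_row (kermx M)).
  rewrite nz_row_eq0 -mxrank_eq0 mxrank_ker subn_eq0 -ltnNge ltnS.
  exact: rank_leq_col.
by apply/sub_kermxP; exact: nz_row_sub.
Qed.

(** The coordinates of [n.+1] unit vectors on [n] generators form a matrix with a nonzero left
    kernel vector. It gives a vanishing combination of unit vectors, whose coefficients must all be
    zero. *)
Lemma ell2_infinite_dimensional : ~ finite_dimensional (ell2 R xpredT).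
Proof.
case=> n [e eP].
pose d (k : nat) : ell2 R xpredT := ell2_of_finseq xpredT 'X^k.
have [c cP] := choice (fun i : 'I_n.+1 => eP (d i)).
have [v v0 vM] := exists_ker_row (\matrix_(i, j) c i j).
move/eqP: v0; apply; apply/rowP => i.
have : \sum_(k < n.+1) v 0 k *: d k = 0.
  under eq_bigr do rewrite cP scaler_sumr.
  rewrite exchange_big big1 // => j _ /=.
  under eq_bigr do rewrite scalerA.
  rewrite -scaler_suml; have := congr1 (fun w : 'rV_n => w 0 j) vM.
  rewrite !mxE => vj.
  rewrite (_ : \sum_(k < n.+1) _ = 0) ?scale0r // -[RHS]vj.
  by apply: eq_bigr => k _; rewrite mxE.
move=> /(congr1 (fun u : ell2 R xpredT => u i)).
rewrite ell2_sum (eq_bigr (fun k : 'I_n.+1 => v 0 k * (i == k)%:R)); last first.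
  by move=> k _; rewrite ell2Z ell2_of_finseqE // coefXn.
rewrite mxE (bigD1 i) //= eqxx mulr1 big1 ?addr0 // => k ki.
by rewrite eq_sym (negbTE ki) mulr0.
Qed.

End ell2_findim.

Lemma countable_enumeration (T : Type) (D : set T) : countable D -> D !=set0 ->
  exists2 x : nat -> T, (forall n, D (x n)) & forall d, D d -> exists n, x n = d.
Proof.
move=> /countable_injP[f finj] [d0 Dd0].
have ex n : exists d, D d /\ forall d', D d' -> f d' = n -> d' = d.
  have [[d [Dd fd]]|h] := pselect (exists d, D d /\ f d = n).
    by exists d; split => // d' Dd' fd'; apply: finj; rewrite ?inE // fd'.
  by exists d0; split => // d' Dd' fd'; case: h; exists d'.
have [x xP] := choice ex.
exists x => [n|d Dd]; first exact: (xP n).1.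
by exists (f d); rewrite -((xP (f d)).2 d).
Qed.

Section density.
Variable R : realType.
Local Notation C := (R[i] : numFieldType).

Definition rat_complex (q : rat * rat) : R[i] := Complex (ratr q.1) (ratr q.2).

Lemma rat_complex_dense (z r : R[i]) : 0 < r -> exists q, `|rat_complex q - z| < r.
Proof.
move=> r0; have s0 : 0 < complex.Re r / 2.
  by move: r0; rewrite ltcE /= => /andP[_ r0]; rewrite divr_gt0.
have rE : r = (complex.Re r / 2 + complex.Re r / 2)%:C%C.
  by rewrite -splitr RRe_real // gtr0_real.
have app (a : R) : exists q : rat, `|ratr q - a| < complex.Re r / 2.
  have [|q] := @rat_in_itvoo R (a - complex.Re r / 2) (a + complex.Re r / 2).
    by rewrite ltrBlDr -addrA ltrDl addr_gt0.
  by rewrite in_itv /= => aq; exists q; rewrite ltr_distl.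
have [a aP] := app (complex.Re z); have [b bP] := app (complex.Im z).
exists (a, b); rewrite rE; apply: (le_lt_trans (norm_le_ReIm _)).
by rewrite ltcR ReB ImB ltrD.
Qed.

Definition rat_finseq (s : seq (rat * rat)) : finseq R[i] :=
  \poly_(k < size s) rat_complex (nth (0, 0) s k).

Lemma rat_finseq_dense : dense (range rat_finseq).
Proof.
move=> O [p Op] Oo.
have [r r0 rO] : nbhs p O by exact: open_nbhs_nbhs.
have [q qP] := choice (fun k => rat_complex_dense (p`_k) (r0 k)).
exists (rat_finseq (mkseq q (size p))); split; last by exists (mkseq q (size p)).
apply: rO => k; rewrite coef_poly size_mkseq.
have [kp|kp] := ltnP k (size p); first by rewrite nth_mkseq.
by rewrite nth_default // subr0 normr0.
Qed.

Lemma dense_image (T U : topologicalType) (f : T -> U) (D : set T) :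
  continuous f -> dense D -> dense (range f) -> dense (f @` D).
Proof.
move=> fc dD df O O0 Oo.
have [y0 [Oy [x _ xy]]] := df O O0 Oo; rewrite -xy in Oy.
have [|y [Oy' Dy]] := dD (f @^-1` O) _ (open_comp (fun x _ => fc x) Oo).
  by exists x.
by exists (f y); split => //; exists y.
Qed.

Lemma separable_of_finseq (T : topologicalType) (f : finseq R[i] -> T) :
  continuous f -> dense (range f) -> separable T.
Proof.
move=> fc df; exists (f @` range rat_finseq); last first.
  by apply: dense_image => //; exact: rat_finseq_dense.
apply: card_le_trans (card_image_le _ _) _; apply: card_le_trans (card_image_le _ _) _.
exact: countableP.
Qed.

Definition ell2_embed : finseq R[i] -> ell2 R xpredT := ell2_of_finseq xpredT.
HB.instance Definition _ := GRing.Linear.on ell2_embed.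

Lemma ell2_embed_continuous : continuous ell2_embed.
Proof. exact: finseq_linear_continuous. Qed.

Lemma ell2_embed_inj : injective ell2_embed.
Proof.
move=> p q pq; apply/polyP => k.
by have := congr1 (fun u : ell2 R xpredT => u k) pq.
Qed.

Lemma ell2_embed_dense : dense (range ell2_embed).
Proof.
move=> O [u Ou] Oo.
have /nbhs_ballP[e /= e0 uO] : nbhs u O by exact: open_nbhs_nbhs.
have e20 : 0 < e / 2 by rewrite divr_gt0.
have [N _ NP] : \forall N \near \oo, `|ell2_inner u u - ell2_partial u u N| <= (e / 2) ^+ 2.
  by apply: (@cvgr_dist_le _ _ _ _ _ _ _ (@ell2_partial_cvg R _ u u)); rewrite exprn_gt0.
pose p : finseq R[i] := \poly_(k < N) u k.
exists (ell2_embed p); split; last by exists p.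
apply: uO; rewrite -ball_normE /=.
apply: (@le_lt_trans _ _ (e / 2)); last by rewrite ltr_pdivrMr // mulr_natr mulr2n ltrDl.
apply: ell2_norm_le; first exact: ltW.
move=> n.
have uE k : `|(u - ell2_embed p) k| ^+ 2 = if (k < N)%N then 0 else `|u k| ^+ 2 :> C.
  rewrite ell2D ell2N /= coef_poly; case: ifP => _; rewrite ?subr0 //.
  by rewrite subrr normr0 expr0n.
have := NP N (leqnn N).
rewrite ger0_norm ?subr_ge0 ?ell2_partial_le //; apply: le_trans.
have key (a b : C) : a + b - a = b by rewrite addrC addKr.
pose S := series (fun k => `|u k| ^+ 2 : C).
apply: (@le_trans _ _ (S (N + n)%N - S N)).
  rewrite /S /series /= (big_cat_nat _ (leq_addr n N)) //= key.
  apply: (@le_trans _ _ (\sum_(0 <= k < N + n) `|(u - ell2_embed p) k| ^+ 2)).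
    rewrite [leRHS](big_cat_nat _ (leq_addl N n)) //= lerDl.
    by apply: sumr_ge0 => k _; rewrite exprn_ge0.
  rewrite (big_cat_nat _ (leq_addr n N)) //= [X in X + _]big_nat_cond [X in X + _]big1 ?add0r.
    by apply: ler_sum => k _; rewrite uE; case: ifP => // _; rewrite exprn_ge0.
  by move=> k /andP[/andP[_ kN] _]; rewrite uE kN.
by rewrite /S -!ell2_partial_diag lerD2r ell2_partial_le.
Qed.

Lemma ell2_separable : separable (ell2 R xpredT).
Proof. exact: separable_of_finseq ell2_embed_continuous ell2_embed_dense. Qed.

End density.

(** * Separable Hilbert spaces as rigged spaces *)

Lemma dense_free_sequence (R : realType) (H : hilbertType R) :
  separable H -> ~ finite_dimensional H ->
  exists b : nat -> H, free_sequence b /\ dense (range (@finseq_lin R[i] H b)).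
Proof.
move=> [D cD dD] Hinf.
have [|x xD Dx] := countable_enumeration cD.
  have [|y [_ Dy]] := dD setT _ openT; first by exists 0.
  by exists y.
have [|b [bfree bx]] := @free_extraction _ H x.
  move=> b n; apply: contrapT => h; apply: Hinf.
  have [t [tb _]] := gram_schmidt (fun i : 'I_n => b i).
  have tx : forall y, hproj t y = y.
    apply: (hproj_dense dD) => y /Dx[m <-].
    have [c ->] : in_span b n (x m) by apply: contrapT => nm; apply: h; exists m.
    rewrite raddf_sum; apply: eq_bigr => i _.
    by rewrite -[in RHS](tb i); exact: (hprojZ t (c i) (b i)).
  exists (size t), (fun i => tnth (in_tuple t) i) => y.
  exists (fun i => inner y (tnth (in_tuple t) i)).
  by rewrite -{1}(tx y) /hproj (big_tnth _ _ t).
exists b; split => // O O0 Oo.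
have [y [Oy Dy]] := dD O O0 Oo; have [m xm] := Dx y Dy.
have [c xc] := bx m; exists y; split => //; exists (\poly_(k < m.+1) c k) => //.
by rewrite finseq_lin_poly -xm xc.
Qed.

Section ell2_union.
Variable R : realType.
Local Notation C := (R[i] : numFieldType).

Definition ell2_below (i : nat) := ell2 R (fun k => (k < i)%N).

Lemma ell2_succ_subproof i (u : ell2_below i) :
  (u : nat -> (R[i])^o) \in @ell2_pred R (fun k => (k < i.+1)%N).
Proof.
apply/asboolP; split; first exact: ell2P.
by move=> k; rewrite -leqNgt => ik; rewrite ell2_supp // -leqNgt ltnW.
Qed.

Definition ell2_succ i (u : ell2_below i) : ell2_below i.+1 := Ell2 (ell2_succ_subproof u).

Lemma ell2_succ_is_linear i : linear (@ell2_succ i).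
Proof. by move=> a u v; apply: ell2_ext. Qed.

HB.instance Definition _ i := GRing.isLinear.Build R[i] (ell2_below i) (ell2_below i.+1) *:%R
  (@ell2_succ i) (@ell2_succ_is_linear i).

Lemma ell2_succ_norm i (u : ell2_below i) : `|ell2_succ u| = `|u|.
Proof. by []. Qed.

Definition finseq_of_ell2 i (u : ell2_below i) : finseq R[i] := \poly_(k < i) u k.

Lemma finseq_of_ell2E i (u : ell2_below i) k : (finseq_of_ell2 u)`_k = u k.
Proof.
by rewrite coef_poly; case: ltnP => // ik; rewrite ell2_supp // -leqNgt.
Qed.

Lemma finseq_of_ell2_is_linear i : linear (@finseq_of_ell2 i).
Proof.
move=> a u v; apply/polyP => k.
by rewrite coefD coefZ !finseq_of_ell2E.
Qed.

HB.instance Definition _ i := GRing.isLinear.Build R[i] (ell2_below i) (finseq R[i]) *:%R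
  (@finseq_of_ell2 i) (@finseq_of_ell2_is_linear i).

Lemma ell2_succ_dist i (u v : ell2_below i) : `|ell2_succ u - ell2_succ v| = `|u - v|.
Proof. by rewrite -raddfB ell2_succ_norm. Qed.

Lemma finseq_strict_inductive_limit :
  strict_inductive_limit (H := fun i => ell2_below i : hilbertType R)
    (fun i => @ell2_succ i : {linear _ -> _}) (fun i => @finseq_of_ell2 i : {linear _ -> _}).
Proof.
split; first split.
- by move=> i u v uv; apply: ell2_ext => k; have := congr1 (fun w : ell2_below i.+1 => w k) uv.
- by move=> i; apply: isometry_continuous => u v; exact: ell2_succ_dist.
- move=> i u v uv; apply: ell2_ext => k; have := congr1 (fun p : finseq R[i] => p`_k) uv.
  by rewrite /= !finseq_of_ell2E.
- by move=> i u; apply/polyP => k; rewrite !finseq_of_ell2E.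
- apply/seteqP; split => // p _; exists (size p) => //.
  exists (ell2_of_finseq _ p) => //; apply/polyP => k.
  by rewrite finseq_of_ell2E /=; case: ltnP => // pk; rewrite nth_default.
- move=> i; apply: finite_dimensional_linear_continuous; exact: ell2_finite_dimensional.
- by move=> E f _ _; exact: finseq_linear_continuous.
- move=> i /seteqP[_ /(_ (ell2_of_finseq _ 'X^i) I)] [u _ uX].
  have := congr1 (fun w : ell2_below i.+1 => w i) uX.
  rewrite ell2_of_finseqE // coefXn eqxx /= ell2_supp ?ltnn // => /eqP.
  by rewrite eq_sym oner_eq0.
- move=> i; apply/seteqP; split => U.
    move=> Uo; pose B := \bigcup_(xe in [set xe : ell2_below i * C | ball xe.1 xe.2 `<=` U])
      ball (ell2_succ xe.1) xe.2.
    exists B; first by apply: bigcup_open => -[x e] _; exact: ball_open.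
    apply/seteqP; split => x.
      move=> [[y e] /= yU]; rewrite -ball_normE /= => yx; apply: yU.
      by rewrite -ball_normE /= -ell2_succ_dist.
    move=> Ux; have /nbhs_ballP[e /= e0 eU] : nbhs x U by exact: open_nbhs_nbhs.
    by exists (x, e) => //; exact: ballxx.
  move=> [B Bo <-]; apply: open_comp => // x _.
  by apply: isometry_continuous => u v; exact: ell2_succ_dist.
Qed.

End ell2_union.

Lemma finseq_rigged (R : realType) (H : hilbertType R) (iota : {linear finseq R[i] -> H}) :
  injective iota -> dense (range iota) -> rigged_hilbert_space iota.
Proof.
move=> iinj idense; split => //.
- exact: finseq_complete (@complex_complete R).
- exact: finseq_nuclear.
- exact: linearP.
- exact: finseq_linear_continuous.
Qed.

Lemma separable_hilbert_rigged (R : realType) (H : hilbertType R) :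
  separable H -> ~ finite_dimensional H ->
  exists (Hs : nat -> hilbertType R)
         (j : forall i : nat, {linear Hs i -> Hs i.+1})
         (Phi : tvsType R[i])
         (phi : forall i : nat, {linear Hs i -> Phi})
         (iota : Phi -> H),
    [/\ forall i : nat, finite_dimensional (Hs i),
        strict_inductive_limit j phi
      & rigged_hilbert_space iota].
Proof.
move=> Hsep Hinf; have [b [bfree bdense]] := dense_free_sequence Hsep Hinf.
exists (fun i => ell2_below R i : hilbertType R), (fun i => @ell2_succ R i : {linear _ -> _}),
  (finseq R[i]), (fun i => @finseq_of_ell2 R i : {linear _ -> _}), (finseq_lin b); split.
- by move=> i; exact: ell2_finite_dimensional.
- exact: finseq_strict_inductive_limit.
- by apply: finseq_rigged => //; exact: finseq_lin_inj.
Qed.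

(** * Coordinates on a strict inductive limit *)

Section linear_homeomorphism.
Variables (K : numFieldType) (E F : tvsType K).
Variables (f : {linear E -> F}) (g : {linear F -> E}).
Hypotheses (fc : continuous f) (gc : continuous g) (fK : cancel f g) (gK : cancel g f).

Lemma complete_tvs_homeo : complete_tvs F -> complete_tvs E.
Proof.
move=> Fcomplete G PG Gc.
have [|l Gl] := Fcomplete (f @ G).
  move=> U U0.
  have fU : nbhs (0 : E) (f @^-1` U) by apply: fc; rewrite raddf0.
  have [[A B] /= [GA GB] AB] := Gc _ fU.
  exists (g @^-1` A, g @^-1` B).
    by split; [apply: filterS GA|apply: filterS GB] => x; rewrite /= fK.
  move=> [x y] /= [Ax By]; have := AB (g x, g y) (conj Ax By).
  by rewrite /= raddfB /= !gK.
exists (g l) => U Ul.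
have h : G (f @^-1` (g @^-1` U)) by exact: Gl _ (gc Ul).
by apply: filterS h => x /=; rewrite fK.
Qed.

Lemma nuclear_space_homeo : nuclear_space F -> nuclear_space E.
Proof.
move=> nF p [p0 pZ pD] pc.
have [||q [[q0 qZ qD] qc pq nq]] := nF (p \o g).
- split => [x|a x|x y] /=; [exact: p0|by rewrite linearZ pZ|by rewrite linearD pD].
- by move=> x; apply: continuous_comp; [exact: gc|exact: pc].
exists (q \o f); split.
- split => [x|a x|x y] /=; [exact: q0|by rewrite linearZ qZ|by rewrite linearD qD].
- by move=> x; apply: continuous_comp; [exact: fc|exact: qc].
- by move=> x; have := pq (f x); rewrite /= fK.
move=> Bq Bp piq pip u [qN qdense] [pN pdense] uc upi.
have rangeg (V : Type) (h : E -> V) : range (h \o g) = range h.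
  apply/seteqP; split => _ [x _ <-]; first by exists (g x).
  by exists (f x) => //=; rewrite fK.
apply: (nq Bq Bp (piq \o g) (pip \o g)) => //.
- by split => [x|]; [rewrite /= qN /= gK|rewrite rangeg].
- by split => [x|]; [rewrite /= pN|rewrite rangeg].
- by move=> x; rewrite /= upi.
Qed.

End linear_homeomorphism.

Section basis.
Variables (R : realType) (Hs : nat -> hilbertType R).
Variables (j : forall i : nat, {linear Hs i -> Hs i.+1}).
Variables (Phi : tvsType R[i]) (phi : forall i : nat, {linear Hs i -> Phi}).
Hypothesis Hs_fin : forall i, finite_dimensional (Hs i).
Hypothesis strict : strict_inductive_limit j phi.

Let phi_mono m n : (m <= n)%N -> range (phi m) `<=` range (phi n).
Proof.
elim: n => [|n IH]; first by rewrite leqn0 => /eqP ->.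
rewrite leq_eqVlt => /predU1P[->//|mn] v /(IH mn)[x _ <-].
by exists (j n x) => //; rewrite (indlim_embed_incl (strict_indlim strict)).
Qed.

Let phi_total v : exists i, range (phi i) v.
Proof.
have : [set: Phi] v by [].
by rewrite -(indlim_union (strict_indlim strict)) => -[i _ vi]; exists i.
Qed.

Let phi_not_onto n : exists v, ~ range (phi n) v.
Proof.
apply: contrapT => h; apply: (strict_neq strict (i := n)).
apply/seteqP; split => // y _.
have [x _ xy] : range (phi n) (phi n.+1 y).
  by apply: contrapT => hy; apply: h; exists (phi n.+1 y).
exists x => //; apply: (indlim_embed_inj (strict_indlim strict) (i := n.+1)).
by rewrite (indlim_embed_incl (strict_indlim strict)).
Qed.

Let prefix_in_range (b : nat -> Phi) n : exists N, forall i, (i < n)%N -> range (phi N) (b i).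
Proof.
elim: n => [|n [N IH]]; first by exists 0%N.
have [M bM] := phi_total (b n); exists (maxn N M) => i.
rewrite ltnS leq_eqVlt => /predU1P[->|/IH]; last by apply: phi_mono; exact: leq_maxl.
by apply: phi_mono bM; exact: leq_maxr.
Qed.

Lemma strict_inductive_limit_basis :
  exists b : nat -> Phi, free_sequence b /\ forall v, exists n, in_span b n v.
Proof.
have phiZ i (a : R[i]) v : phi i (a *: v) = a *: phi i v by exact: linearZ.
have gen i : exists c : nat * (nat -> Phi), forall y, in_span c.2 c.1 (phi i y).
  have [n [e eP]] := Hs_fin i.
  exists (n, fun k => if insub k is Some l then phi i (e l) else 0) => y /=.
  have [c ->] := eP y.
  exists (fun k => if insub k is Some l then c l else 0).
  by rewrite raddf_sum; apply: eq_bigr => l _; rewrite valK; exact: phiZ.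
have [c cP] := choice gen.
pose x m : Phi := if @unpickle (nat * nat)%type m is Some ik then (c ik.1).2 ik.2 else 0.
have phiE i y : exists d : nat -> R[i],
    phi i y = \sum_(k < (c i).1) d k *: x (pickle (i, k : nat)).
  have [d yE] := cP i y; exists d; rewrite yE; apply: eq_bigr => k _.
  by rewrite /x pickleK.
have [|b [bfree bx]] := @free_extraction _ Phi x.
  move=> b n; apply: contrapT => h.
  have [N bN] := prefix_in_range b n; have [v vN] := phi_not_onto N; apply: vN.
  have rangeN w : in_span b n w -> range (phi N) w.
    move=> [d ->]; have ex (i : 'I_n) : exists y, phi N y = b i.
      by have [y _ yb] := bN i (ltn_ord i); exists y.
    have [y yP] := choice ex.
    exists (\sum_(i < n) d i *: y i) => //; rewrite raddf_sum; apply: eq_bigr => k _.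
    by rewrite -yP; exact: phiZ.
  apply: rangeN; have [i [y _ <-]] := phi_total v.
  have [d ->] := phiE i y.
  by apply: in_span_sum => k; apply: contrapT => hk; apply: h; exists (pickle (i, k : nat)).
exists b; split => // v.
have [i [y _ <-]] := phi_total v; have [d ->] := phiE i y.
exists (\max_(k < (c i).1) (pickle (i, k : nat)).+1).
apply: in_span_sum => k; apply: in_spanS (bx _).
by rewrite (leq_bigmax (F := fun k : 'I__ => (pickle (i, k : nat)).+1)).
Qed.

End basis.

Lemma finseq_lin_inverse (K : numFieldType) (V : lmodType K) (b : nat -> V) :
  free_sequence b -> (forall v, exists n, in_span b n v) ->
  exists f : {linear V -> finseq K}, cancel f (finseq_lin b) /\ cancel (finseq_lin b) f.
Proof.
move=> bfree bspan.
have ex v : exists p : finseq K, finseq_lin b p = v.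
  have [n [c ->]] := bspan v; exists (\poly_(k < n) c k); exact: finseq_lin_poly.
have [f fK] := choice ex.
have f_lin : linear (f : V -> finseq K).
  by move=> a u v; apply: (finseq_lin_inj bfree); rewrite linearP /= !fK.
pose g : {linear V -> finseq K} := HB.pack f (GRing.isLinear.Build K V (finseq K) *:%R f f_lin).
by exists g; split => // p; apply: (finseq_lin_inj bfree); exact: fK.
Qed.

Lemma strict_inductive_limit_rigged (R : realType) (Hs : nat -> hilbertType R)
    (j : forall i : nat, {linear Hs i -> Hs i.+1})
    (Phi : tvsType R[i])
    (phi : forall i : nat, {linear Hs i -> Phi}) :
  (forall i : nat, finite_dimensional (Hs i)) ->
  strict_inductive_limit j phi ->
  exists (H : hilbertType R) (iota : Phi -> H),
    [/\ separable H, ~ finite_dimensional H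
      & rigged_hilbert_space iota].
Proof.
move=> Hfin strict.
have [b [bfree bspan]] := strict_inductive_limit_basis Hfin strict.
have [f [fK gK]] := finseq_lin_inverse bfree bspan.
have gc : continuous (finseq_lin b : finseq R[i] -> Phi) by exact: finseq_linear_continuous.
have fc : continuous f.
  apply: (indlim_finest (strict_indlim strict)); first by exists (finseq_lin b).
  move=> i; have fphic := @finite_dimensional_linear_continuous
    R (Hs i) (finseq R[i]) (f \o phi i) (Hfin i).
  exact: fphic.
exists (ell2 R xpredT : hilbertType R), (@ell2_embed R \o f); split.
- exact: ell2_separable.
- exact: ell2_infinite_dimensional.
split.
- exact: (complete_tvs_homeo fc gc fK gK (finseq_complete (@complex_complete R))).
- exact: (nuclear_space_homeo fc gc fK gK (@finseq_nuclear R)).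
- exact: linearP.
- by move=> x; apply: continuous_comp; [exact: fc|exact: ell2_embed_continuous].
- exact: inj_comp (@ell2_embed_inj R) (can_inj fK).
rewrite (_ : range _ = range (@ell2_embed R)); first exact: ell2_embed_dense.
apply/seteqP; split => _ [x _ <-]; first by exists (f x).
by exists (finseq_lin b x) => //=; rewrite gK.
Qed.

Theorem proposition2 (R : realType) :
  (forall H : hilbertType R,
     separable H -> ~ finite_dimensional H ->
     exists (Hs : nat -> hilbertType R)
            (j : forall i : nat, {linear Hs i -> Hs i.+1})
            (Phi : tvsType R[i])
            (phi : forall i : nat, {linear Hs i -> Phi})
            (iota : Phi -> H),
       [/\ forall i : nat, finite_dimensional (Hs i),
           strict_inductive_limit j phi
         & rigged_hilbert_space iota])
  /\
  (forall (Hs : nat -> hilbertType R)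
          (j : forall i : nat, {linear Hs i -> Hs i.+1})
          (Phi : tvsType R[i])
          (phi : forall i : nat, {linear Hs i -> Phi}),
     (forall i : nat, finite_dimensional (Hs i)) ->
     strict_inductive_limit j phi ->
     exists (H : hilbertType R) (iota : Phi -> H),
       [/\ separable H, ~ finite_dimensional H
         & rigged_hilbert_space iota]).
Proof.
split; first exact: separable_hilbert_rigged.
exact: strict_inductive_limit_rigged.
Qed.
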